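(* Let $|\psi\rangle\in\mathcal{H}_A\otimes\mathcal{H}_B\otimes\mathcal{H}_C$ be a Haar random pure state of $n=n_A+n_B+n_C$ qubits, let $\rho=\mathrm{tr}_C(|\psi\rangle\langle\psi|)$ and $n_{AB}=n_A+n_B$. In the thermodynamic limit, to leading order: (i) if $n_C>n_{AB}$, then $\mathbb{E}_{\mathrm H}[\mathcal{E}(\rho)]\simeq\mathbb{E}_{\mathrm H}[\mathcal{E}_4(\rho)]\simeq0$; (ii) if $n_C<n_{AB}$ and both $n_A<n/2$ and $n_B<n/2$, then $\mathbb{E}_{\mathrm H}[\mathcal{E}(\rho)]\simeq\mathbb{E}_{\mathrm H}[\mathcal{E}_4(\rho)]\simeq\frac12(n_{AB}-n_C)\ln2$; (iii) if $n_C<n_{AB}$ and either $n_A>n/2$ or $n_B>n/2$, then $\mathbb{E}_{\mathrm H}[\mathcal{E}(\rho)]\simeq\mathbb{E}_{\mathrm H}[\mathcal{E}_4(\rho)]\simeq\min(n_A,n_B)\ln2$. Moreover, the same holds with the Haar average replaced by the average over any ensemble of pure states forming a state $4$-design.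
   Context: Subsystem $X\in\{A,B,C\}$ consists of $n_X$ qubits; $\mathbb{E}_{\mathrm H}$ is the average over the Haar measure on pure states. Thermodynamic limit: $n\to\infty$ with the fractions $n_X/n$ fixed (in the open regions of the stated inequalities); $\simeq$ denotes equality of the leading order in $n$, i.e. up to $o(n)$. The partial transpose on $B$ is $(X_A\otimes Y_B)^\Gamma=X_A\otimes Y_B^T$; $\mathcal{E}(\rho)=\ln\|\rho^\Gamma\|_1$; $p_\alpha=\mathrm{tr}((\rho^\Gamma)^\alpha)$; $\mathcal{E}_4(\rho)=\frac12\ln(p_2^3/p_4)$. A state $t$-design is an ensemble of pure states whose average of $(|\psi\rangle\langle\psi|)^{\otimes t}$ equals the Haar average. *)

(* Defs.v *)
From HB Require Import structures.
From mathcomp Require Import all_boot all_order all_algebra.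
From mathcomp Require Import all_classical all_reals all_analysis.
From mathcomp Require Import complex mxtens.

Set Implicit Arguments.
Unset Strict Implicit.
Unset Printing Implicit Defensive.
Import Order.TTheory GRing.Theory Num.Theory.
Import numFieldNormedType.Exports.

Local Open Scope classical_set_scope.
Local Open Scope complex_scope.
Local Open Scope sesquilinear_scope.
Local Open Scope ring_scope.

Section Matrices.
Variable R : realType.
Local Notation C := R[i].

(* Bipartite spaces use the index encoding of the Kronecker product [*t]:
   [mxtens_index (i, j)] labels the basis vector e_i (x) e_j. *)

(* Partial trace over the second tensor factor. *)
Definition ptrace m n (M : 'M[C]_(m * n)) : 'M[C]_m :=
  \matrix_(i, j) \sum_(k < n) M (mxtens_index (i, k)) (mxtens_index (j, k)).

(* Partial transpose on the second tensor factor. *)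
Definition ptranspose m n (M : 'M[C]_(m * n)) : 'M[C]_(m * n) :=
  \matrix_(i, j) M (mxtens_index ((mxtens_unindex i).1, (mxtens_unindex j).2))
                   (mxtens_index ((mxtens_unindex j).1, (mxtens_unindex i).2)).

Lemma ptrace_tens m n (X : 'M[C]_m) (Y : 'M[C]_n) :
  ptrace (X *t Y) = \tr Y *: X.
Proof.
apply/matrixP => i j; rewrite !mxE mulrC /mxtrace mulr_sumr.
by apply: eq_bigr => k _; rewrite tensmxE.
Qed.

Lemma ptranspose_tens m n (X : 'M[C]_m) (Y : 'M[C]_n) :
  ptranspose (X *t Y) = X *t Y^T.
Proof. by apply/matrixP => i j; rewrite !mxE !mxtens_indexK. Qed.

(* Square root of a positive semidefinite matrix, by functional calculus. *)
Definition sqrtmx n (A : 'M[C]_n) : 'M[C]_n :=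
  invmx (spectralmx A) *m diag_mx (map_mx sqrtC (spectral_diag A))
    *m spectralmx A.

(* Trace norm, tr sqrt(A^* A); the trace is a nonnegative real of C. *)
Definition trace_norm n (A : 'M[C]_n) : R :=
  complex.Re (\tr (sqrtmx (A ^t* *m A))).

(* p_alpha and both negativities take rho on A (x) B, of dimensions m and n.
   The trace in p_alpha is real as soon as rho is Hermitian. *)
Definition pt_moment m n (alpha : nat) (rho : 'M[C]_(m * n)) : R :=
  complex.Re (\tr (ptranspose rho ^+ alpha)).

Definition log_negativity m n (rho : 'M[C]_(m * n)) : R :=
  ln (trace_norm (ptranspose rho)).

Definition log_negativity4 m n (rho : 'M[C]_(m * n)) : R :=
  2^-1 * ln (pt_moment 2 rho ^+ 3 / pt_moment 4 rho).

End Matrices.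

Section States.
Variable R : realType.
Local Notation C := R[i].

(* Vectors of C^D.  The real and imaginary parts of the amplitudes generate the
   Borel sigma-algebra. *)
Definition ket (D : nat) := 'cV[C]_D.

HB.instance Definition _ D := Choice.on (ket D).
HB.instance Definition _ D := isPointed.Build (ket D) 0.

Definition amplitude D (i : 'I_D) (psi : ket D) : R * R :=
  (complex.Re (psi i ord0), complex.Im (psi i ord0)).

HB.instance Definition _ D :=
  @isMeasurable.Build default_measure_display (ket D)
    (g_sigma_preimage (@amplitude D))
    (@sigma_algebra0 _ _ _) (@sigma_algebraC _ _) (@sigma_algebra_bigcup _ _ _).

Definition proj_ket D (psi : ket D) : 'M[C]_D := psi *m psi ^t*.

(* Ensembles of pure states: Borel probability measures carried by the unit
   vectors (finite weighted ensembles are sums of Dirac masses). *)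
Definition pure_ensemble D (mu : probability (ket D) R) : Prop :=
  mu [set psi : ket D | \sum_(i < D) `|psi i ord0| ^+ 2 = 1] = 1%E.

(* The Haar measure on pure states is the unique unitarily invariant one. *)
Definition haar D (mu : probability (ket D) R) : Prop :=
  pure_ensemble mu /\
  forall (U : 'M[C]_D) (A : set (ket D)),
    U \is unitarymx -> measurable A -> mu [set psi : ket D | A (U *m psi)] = mu A.

Definition average D (mu : probability (ket D) R) (f : ket D -> R) : R :=
  \int[mu]_psi f psi.

Definition average_mx D (mu : probability (ket D) R) m n
    (F : ket D -> 'M[C]_(m, n)) : 'M[C]_(m, n) :=
  \matrix_(i, j) (average mu (fun psi => complex.Re (F psi i j)) +i*
                  average mu (fun psi => complex.Im (F psi i j))).

Definition state_design D (t : nat) (nu : probability (ket D) R) : Prop :=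
  pure_ensemble nu /\
  forall mu : probability (ket D) R, haar mu ->
    average_mx nu (fun psi => ntensmx (proj_ket psi) t) =
    average_mx mu (fun psi => ntensmx (proj_ket psi) t).

Definition reduced_AB dA dB dC (psi : ket (dA * dB * dC)) :
    'M[C]_(dA * dB) :=
  ptrace (proj_ket psi).

(* n_A, n_B, n_C range over sequences with n = n_A + n_B + n_C -> oo and
   n_X / n constant, equal to [a], [b], [c]. *)
Definition thermodynamic_limit (a b c : R) (nA nB nC : nat -> nat) : Prop :=
  let n k := (nA k + nB k + nC k)%N in
  n @ \oo --> \oo /\
  forall k, [/\ (nA k)%:R = a * (n k)%:R, (nB k)%:R = b * (n k)%:R
              & (nC k)%:R = c * (n k)%:R].

Definition leading_eq (n : nat -> nat) (u v : nat -> R) : Prop :=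
  u = v +o_\oo (fun k => (n k)%:R : R).

(* The three regimes for the averages over the measures [mu k]. *)
Definition negativity_phases (nA nB nC : nat -> nat)
    (mu : forall k, probability (ket (2 ^ nA k * 2 ^ nB k * 2 ^ nC k)) R) :
    Prop :=
  let n k := (nA k + nB k + nC k)%N in
  let nAB k := (nA k + nB k)%N in
  let EN k := average (mu k) (fun psi => log_negativity (reduced_AB psi)) in
  let EN4 k := average (mu k) (fun psi => log_negativity4 (reduced_AB psi)) in
  [/\ (forall k, (nAB k < nC k)%N) ->
        leading_eq n EN EN4 /\ leading_eq n EN4 (fun=> 0),
      (forall k, [/\ (nC k < nAB k)%N, (nA k)%:R < (n k)%:R / 2 :> R
                   & (nB k)%:R < (n k)%:R / 2 :> R]) ->
        leading_eq n EN EN4 /\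
        leading_eq n EN4
          (fun k => 2^-1 * ((nAB k)%:R - (nC k)%:R) * ln 2)
    & (forall k, (nC k < nAB k)%N /\
                 ((n k)%:R / 2 < (nA k)%:R :> R \/
                  (n k)%:R / 2 < (nB k)%:R :> R)) ->
        leading_eq n EN EN4 /\
        leading_eq n EN4 (fun k => (minn (nA k) (nB k))%:R * ln 2)].

End States.

(* Main.v *)
Require Import Defs.
From mathcomp Require Import all_boot all_order all_algebra.
From mathcomp Require Import all_classical all_reals all_analysis.
From mathcomp Require Import fingroup perm measurable_realfun.
From mathcomp Require Import complex mxtens ring lra zify.

(** On unit vectors both negativities are squeezed between affine functions of
    the moment [p_4]: the purity is at least [1 / d_AB] and [1 / d_C], Hoelder's
    inequality gives [E_4 <= E], and [E] is bounded through [p_4] and the rank of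
    the partial transpose, which is at most [d_AB], [d_B^2 d_C] and [d_A^2 d_C].
    So a bound of the right order on the mean of [p_4] suffices, and only it uses
    the ensemble.  Invariance under diagonal phases kills every monomial
    [psi_i1 .. psi_i4 conj(psi_j1 .. psi_j4)] whose indices do not match under a
    permutation; the others are at most [max_i E |psi_i|^8 = O(D^-4)], which
    follows by mixing two amplitudes at a time.  The mean of [p_4] is therefore
    [O(D^-4)] times a sum over the 24 permutations [s] of
    [d_A^#(t s) d_B^#(t^-1 s) d_C^#(s)], [#] counting cycles and [t] a 4-cycle;
    the genus inequalities [#(s) + #(t s) <= 5], [#(s) + #(t^-1 s) <= 5],
    [#(t s) + #(t^-1 s) <= 6] identify the dominant term in each phase. *)

Set Implicit Arguments.
Unset Strict Implicit.
Unset Printing Implicit Defensive.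
Import Order.TTheory GRing.Theory Num.Theory.
Import numFieldNormedType.Exports.

Local Open Scope classical_set_scope.
Local Open Scope complex_scope.
Local Open Scope sesquilinear_scope.
Local Open Scope ring_scope.

(** * Power sums and ranks *)

Section PowerSums.
Variable R : realType.

(** Lagrange's identity: the double sum of [(a i * b j - a j * b i) ^+ 2] is twice the difference of
    the two sides. *)
Lemma cauchy_schwarz_sum (I : finType) (a b : I -> R) :
  (\sum_i a i * b i) ^+ 2 <= (\sum_i a i ^+ 2) * (\sum_i b i ^+ 2).
Proof.
have E1 : (\sum_i a i * b i) ^+ 2 = \sum_i \sum_j a i * b i * (a j * b j).
  by rewrite expr2 mulr_suml; apply: eq_bigr => i _; rewrite mulr_sumr.
have E2 : (\sum_i a i ^+ 2) * (\sum_i b i ^+ 2) =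
    \sum_i \sum_j a i ^+ 2 * b j ^+ 2.
  by rewrite mulr_suml; apply: eq_bigr => i _; rewrite mulr_sumr.
have E3 : \sum_i \sum_j a i ^+ 2 * b j ^+ 2 = \sum_i \sum_j a j ^+ 2 * b i ^+ 2.
  by rewrite exchange_big.
have : 0 <= \sum_i \sum_j (a i * b j - a j * b i) ^+ 2.
  by do 2! apply: sumr_ge0 => ? _; rewrite sqr_ge0.
have -> : \sum_i \sum_j (a i * b j - a j * b i) ^+ 2 =
    \sum_i \sum_j a i ^+ 2 * b j ^+ 2 + \sum_i \sum_j a j ^+ 2 * b i ^+ 2
    - 2 * \sum_i \sum_j a i * b i * (a j * b j).
  rewrite mulr_sumr -big_split -sumrB /=; apply: eq_bigr => i _.
  rewrite mulr_sumr -big_split -sumrB /=; apply: eq_bigr => j _; ring.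
rewrite -E3 -E1 -E2; lra.
Qed.

(** Two uses of Cauchy-Schwarz through the third power sum [T]: [A ^+ 2 <= B * T] and
    [T ^+ 2 <= A * C] give [A ^+ 4 <= B ^+ 2 * A * C], and a factor [A] cancels. *)
Lemma power_sum_holder (I : finType) (s : I -> R) : (forall i, 0 <= s i) ->
  (\sum_i s i ^+ 2) ^+ 3 <= (\sum_i s i) ^+ 2 * \sum_i s i ^+ 4.
Proof.
move=> s0.
set A := \sum_i s i ^+ 2; set B := \sum_i s i; set C := \sum_i s i ^+ 4.
pose T := \sum_i s i ^+ 3.
have A0 : 0 <= A by apply: sumr_ge0 => i _; rewrite sqr_ge0.
have B0 : 0 <= B by apply: sumr_ge0.
have T0 : 0 <= T by apply: sumr_ge0 => i _; rewrite exprn_ge0.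
have H1 : A ^+ 2 <= B * T.
  have := @cauchy_schwarz_sum I (fun i => Num.sqrt (s i))
    (fun i => Num.sqrt (s i) * s i).
  have -> : \sum_i Num.sqrt (s i) * (Num.sqrt (s i) * s i) = A.
    by apply: eq_bigr => i _; rewrite mulrA -expr2 sqr_sqrtr.
  have -> : \sum_i Num.sqrt (s i) ^+ 2 = B.
    by apply: eq_bigr => i _; rewrite sqr_sqrtr.
  have -> // : \sum_i (Num.sqrt (s i) * s i) ^+ 2 = T.
  by apply: eq_bigr => i _; rewrite exprMn sqr_sqrtr.
have H2 : T ^+ 2 <= A * C.
  have := @cauchy_schwarz_sum I (fun i => s i) (fun i => s i ^+ 2).
  have -> : \sum_i s i * s i ^+ 2 = T by apply: eq_bigr => i _; rewrite -exprS.
  have -> // : \sum_i (s i ^+ 2) ^+ 2 = C.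
  by apply: eq_bigr => i _; rewrite -exprM.
have [A00|An0] := eqVneq A 0.
  rewrite A00 expr0n /= mulr_ge0 ?sqr_ge0 //.
  by apply: sumr_ge0 => i _; rewrite exprn_ge0.
have Ap : 0 < A by rewrite lt_def An0.
rewrite -(ler_pM2l Ap).
have -> : A * A ^+ 3 = (A ^+ 2) ^+ 2 by ring.
apply: (@le_trans _ _ ((B * T) ^+ 2)).
  by rewrite lerXn2r ?nnegrE ?sqr_ge0 ?mulr_ge0.
by rewrite exprMn [leRHS]mulrCA ler_wpM2l ?sqr_ge0.
Qed.

(** Cauchy-Schwarz against the indicator [e] of the support, applied to the exponents 1 and then
    2. *)
Lemma power_sum_support (I : finType) (s : I -> R) (r : nat) :
  (forall i, 0 <= s i) -> (#|[pred i | s i != 0%R]| <= r)%N ->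
  (\sum_i s i) ^+ 4 <= r%:R ^+ 3 * \sum_i s i ^+ 4.
Proof.
move=> s0 hr.
pose e i : R := (s i != 0)%:R.
have He : \sum_i e i ^+ 2 <= r%:R.
  apply: le_trans (_ : #|[pred i | s i != 0%R]|%:R <= _); last by rewrite ler_nat.
  rewrite -sum1_card natr_sum [leRHS]big_mkcond /= ler_sum // => i _.
  by rewrite inE /e; case: eqP => _ /=; rewrite ?expr0n ?expr1n.
have He0 : 0 <= \sum_i e i ^+ 2 by apply: sumr_ge0 => i _; rewrite sqr_ge0.
have H1 (k : nat) : (0 < k)%N ->
    (\sum_i s i ^+ k) ^+ 2 <= r%:R * \sum_i s i ^+ (2 * k).
  move=> k0; have := @cauchy_schwarz_sum I e (fun i => s i ^+ k).
  have -> : \sum_i e i * s i ^+ k = \sum_i s i ^+ k.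
    apply: eq_bigr => i _; rewrite /e; case: eqP => [->|_] /=; last by rewrite mul1r.
    by rewrite expr0n eqn0Ngt k0 mul0r.
  have -> : \sum_i (s i ^+ k) ^+ 2 = \sum_i s i ^+ (2 * k).
    by apply: eq_bigr => i _; rewrite -exprM mulnC.
  move=> /le_trans; apply; rewrite ler_wpM2r //.
  by apply: sumr_ge0 => i _; rewrite exprn_ge0.
have := H1 1%N isT; rewrite muln1 => /= Ha; have /= Hb := H1 2 isT.
have -> : (\sum_i s i) ^+ 4 = ((\sum_i s i ^+ 1) ^+ 2) ^+ 2 by rewrite -exprM.
have S2 : 0 <= \sum_i s i ^+ 2 by apply: sumr_ge0 => i _; rewrite sqr_ge0.
apply: (@le_trans _ _ ((r%:R * \sum_i s i ^+ 2) ^+ 2)).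
  by rewrite lerXn2r ?nnegrE ?sqr_ge0 ?mulr_ge0.
by rewrite exprMn (exprSr _ 2) -[leRHS]mulrA ler_wpM2l ?sqr_ge0.
Qed.

End PowerSums.

Lemma mxrank_diag (F : fieldType) n (d : 'rV[F]_n) :
  \rank (diag_mx d) = #|[pred i | d 0 i != 0]|.
Proof.
elim: n d => [|n IH] d.
  by rewrite thinmx0 mxrank0; symmetry; apply: eq_card0 => -[].
pose l := lsubmx (d : 'rV_(1 + n)); pose r := rsubmx (d : 'rV_(1 + n)).
transitivity (\rank (block_mx (diag_mx l) 0 0 (diag_mx r))).
  by rewrite -diag_mx_row hsubmxK.
rewrite rank_diag_block_mx IH -!sum1_card.
rewrite [RHS]big_mkcond [in RHS]big_ord_recl -big_mkcond /=; congr (_ + _)%N.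
  rewrite [diag_mx _]mx11_scalar !mxE eqxx mulr1n rank_rV.
  rewrite inE (_ : lshift n 0 = ord0); last exact: val_inj.
  have [->|d0] := eqVneq (d 0 ord0) 0; first by rewrite raddf0 eqxx.
  case: eqP => // /matrixP/(_ 0 0) /eqP; rewrite !mxE eqxx mulr1n.
  by rewrite (negPf d0).
apply: eq_bigl => i; rewrite !inE !mxE.
by rewrite (_ : rshift 1 i = lift ord0 i) //; exact: val_inj.
Qed.

(** * The trace norm of a Hermitian matrix *)

Section TraceNorm.
Variable R : realType.
Local Notation C := R[i].

Lemma Re_ge0_complex (z : C) : 0 <= z -> z = (complex.Re z)%:C.
Proof. by case: z => x y; rewrite lecE /= => /andP[/eqP -> _]. Qed.

(** The [s i] are the square roots of the eigenvalues of [B = A ^t* *m A]. Diagonalizing [B] rather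
    than [A] fits the definition of the trace norm, and for Hermitian [A] it suffices for the even
    moments, since [B] is the square of [A]. *)
Lemma hermitian_singular_values n (A : 'M[C]_n) : A ^t* = A ->
  exists s : 'I_n -> R,
  [/\ forall i, 0 <= s i, trace_norm A = \sum_i s i,
      complex.Re (\tr (A ^+ 2)) = \sum_i s i ^+ 2,
      complex.Re (\tr (A ^+ 4)) = \sum_i s i ^+ 4
    & (#|[pred i | s i != 0%R]| <= \rank A)%N].
Proof.
move=> hA; pose B := A ^t* *m A; pose P := spectralmx B; pose d := spectral_diag B.
have hB : B ^t* = B by rewrite /B hA trmx_mul map_mxM /= hA.
have nB : B \is normalmx by apply/normalmxP; rewrite hB.
have uP : P \is unitarymx by exact: spectral_unitarymx.
have PU : P \in unitmx by exact: unitarymx_unit.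
have EB : B = invmx P *m diag_mx d *m P by exact/orthomx_spectralP.
have Ed : diag_mx d = P *m B *m invmx P by rewrite EB !mulmxA mulmxV // mul1mx mulmxK.
(* In the eigenbasis [B] is the Gram matrix of [A *m P ^t*], whose diagonal entries are sums of
   squared moduli. *)
have d0 i : 0 <= d 0 i.
  have -> : d 0 i = (diag_mx d) i i by rewrite mxE eqxx mulr1n.
  rewrite Ed invmx_unitary // /B.
  have -> : P *m (A ^t* *m A) *m P ^t* = (A *m P ^t*) ^t* *m (A *m P ^t*).
    by rewrite trmx_mul map_mxM /= trmxCK !mulmxA.
  rewrite mxE sumr_ge0 // => k _; rewrite !mxE mulrC.
  by rewrite -normCK exprn_ge0.
pose s i := complex.Re (sqrtC (d 0 i)).
have Es i : sqrtC (d 0 i) = (s i)%:C by apply: Re_ge0_complex; rewrite sqrtC_ge0.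
have Eds i : d 0 i = ((s i) ^+ 2)%:C.
  by rewrite -[LHS]sqrtCK Es rmorphXn.
have s0 i : 0 <= s i by have := d0 i; rewrite -sqrtC_ge0 Es lecR.
have trP (M : 'M[C]_n) : \tr (invmx P *m M *m P) = \tr M.
  by rewrite mxtrace_mulC mulmxA mulmxV // mul1mx.
have ReS (F : 'I_n -> R) : complex.Re (\sum_i (F i)%:C) = \sum_i F i.
  by rewrite -rmorph_sum.
exists s; split=> //.
- rewrite /trace_norm /sqrtmx trP mxtrace_diag -ReS.
  by congr complex.Re; apply: eq_bigr => i _; rewrite mxE -Es.
- rewrite expr2 -mulmxE -{1}hA -/B EB trP mxtrace_diag -ReS.
  by congr complex.Re; apply: eq_bigr => i _; rewrite Eds.
- have -> : A ^+ 4 = B *m B by rewrite (exprM A 2 2) !expr2 -!mulmxE /B hA.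
  rewrite EB !mulmxA mulmxK // -(mulmxA (invmx P)) trP mulmx_diag mxtrace_diag -ReS.
  congr complex.Re; apply: eq_bigr => i _.
  by rewrite mxE Eds -rmorphM -exprD.
(* The support of [s] is that of the spectrum of [B], so its size is the rank of [B], at most that
   of [A]. *)
- have -> : #|[pred i | s i != 0]| = #|[pred i | d 0 i != 0]|.
    apply: eq_card => i; rewrite !inE Eds rmorphXn expf_eq0 /=.
    by rewrite (inj_eq (@complexI _)).
  rewrite -mxrank_diag Ed mxrankMfree ?row_free_unit ?unitmx_inv //.
  rewrite (eqmxMfull _ _) ?row_full_unit // /B.
  exact: mxrankM_maxr.
Qed.

Lemma trace_norm_holder n (A : 'M[C]_n) : A ^t* = A ->
  complex.Re (\tr (A ^+ 2)) ^+ 3 <=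
    trace_norm A ^+ 2 * complex.Re (\tr (A ^+ 4)).
Proof.
by move=> /hermitian_singular_values[s [s0 -> -> -> _]]; exact: power_sum_holder.
Qed.

Lemma trace_norm_rank n (A : 'M[C]_n) (r : nat) : A ^t* = A -> (\rank A <= r)%N ->
  trace_norm A ^+ 4 <= r%:R ^+ 3 * complex.Re (\tr (A ^+ 4)).
Proof.
move=> /hermitian_singular_values[s [s0 -> _ -> hr]] hr'.
by apply: power_sum_support => //; exact: leq_trans hr'.
Qed.

Lemma trace_norm_ge0 n (A : 'M[C]_n) : A ^t* = A -> 0 <= trace_norm A.
Proof.
by move=> /hermitian_singular_values[s [s0 -> _ _ _]]; rewrite sumr_ge0.
Qed.

Lemma hermitian_trace_pow4_gt0 n (A : 'M[C]_n) : A ^t* = A ->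
  0 < complex.Re (\tr (A ^+ 2)) -> 0 < complex.Re (\tr (A ^+ 4)).
Proof.
move=> /hermitian_singular_values[s [s0 _ -> -> _]] h.
have p0 (i : 'I_n) : true -> 0 <= s i ^+ 4 by rewrite exprn_ge0.
rewrite lt_def sumr_ge0 // andbT psumr_eq0 //; apply/negP => /allP h4.
move: h; rewrite big1 ?ltxx // => i _.
by have := h4 i (mem_index_enum _); rewrite /= !expf_eq0 => /eqP ->; rewrite expr0n.
Qed.

End TraceNorm.

(** * The partially transposed reduced state *)

Lemma big_mxtens (V : nmodType) m n (F : 'I_(m * n) -> V) :
  \sum_i F i = \sum_(a < m) \sum_(b < n) F (mxtens_index (a, b)).
Proof.
rewrite pair_big /= (reindex (@mxtens_index m n)) /=.
  by apply: eq_bigr => -[].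
by exists (@mxtens_unindex m n) => i _; rewrite (mxtens_indexK, mxtens_unindexK).
Qed.

(** The hypothesis factors [M] through a space of dimension [#|K|]; an arbitrary finite type [K]
    allows tuples of indices as intermediate labels. *)
Lemma mxrank_factor_le (F : fieldType) m n (K : finType) (M : 'M[F]_(m, n))
    (X : 'I_m -> K -> F) (Y : K -> 'I_n -> F) :
  (forall x y, M x y = \sum_k X x k * Y k y) -> (\rank M <= #|K|)%N.
Proof.
move=> EM; suff -> : M = (\matrix_(x < m, k < #|K|) X x (enum_val k)) *m
    (\matrix_(k < #|K|, y < n) Y (enum_val k) y) by exact: mulmx_max_rank.
apply/matrixP => x y; rewrite EM mxE (reindex _ (onW_bij _ (@enum_val_bij K))).
by apply: eq_bigr => k _; rewrite !mxE.
Qed.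

Section ReducedState.
Variable R : realType.
Local Notation C := R[i].

Lemma Re_sqr_norm (z : C) :
  complex.Re (`|z| ^+ 2) = complex.Re z ^+ 2 + complex.Im z ^+ 2.
Proof. by rewrite normCK; case: z => x y /=; ring. Qed.

Lemma hermitian_trace_sqE n (G : 'M[C]_n) : G ^t* = G ->
  complex.Re (\tr (G ^+ 2)) = \sum_i \sum_j complex.Re (`|G i j| ^+ 2).
Proof.
move=> hG; rewrite expr2 -mulmxE /mxtrace raddf_sum; apply: eq_bigr => i _.
rewrite mxE raddf_sum; apply: eq_bigr => j _.
by rewrite normCK; congr (complex.Re (_ * _)); rewrite -{1}hG !mxE.
Qed.

(** Cauchy-Schwarz on the diagonal entries; the off-diagonal entries only increase the
    Hilbert-Schmidt norm. *)
Lemma hermitian_trace_sq_ge n (G : 'M[C]_n) : G ^t* = G ->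
  complex.Re (\tr G) ^+ 2 <= n%:R * complex.Re (\tr (G ^+ 2)).
Proof.
move=> hG; rewrite hermitian_trace_sqE // /mxtrace raddf_sum.
have := cauchy_schwarz_sum (fun _ : 'I_n => 1) (fun i => complex.Re (G i i)).
rewrite /= (eq_bigr _ (fun i _ => mul1r _)) (eq_bigr _ (fun i _ => expr1n _ _)).
rewrite sumr_const card_ord => /le_trans; apply.
rewrite ler_wpM2l ?ler0n // ler_sum // => i _.
have Q (z : C) : 0 <= complex.Re (`|z| ^+ 2) by rewrite Re_sqr_norm addr_ge0 ?sqr_ge0.
apply: (@le_trans _ _ (complex.Re (`|G i i| ^+ 2))).
  by rewrite Re_sqr_norm lerDl sqr_ge0.
rewrite [leRHS](bigD1 i) // lerDl; apply: sumr_ge0 => j _; exact: Q.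
Qed.

(** Partial transposition exchanges [b] and [b'] in both factors of each term, which merely relabels
    the sum. Hence [p_2] is the purity. *)
Lemma trace_ptranspose_sq m n (M : 'M[C]_(m * n)) :
  \tr (ptranspose M ^+ 2) = \tr (M ^+ 2).
Proof.
rewrite !expr2 -!mulmxE /mxtrace.
under eq_bigr do rewrite mxE.
under [RHS]eq_bigr do rewrite mxE.
rewrite !big_mxtens; apply: eq_bigr => a _.
under eq_bigr do rewrite big_mxtens.
under [RHS]eq_bigr do rewrite big_mxtens.
rewrite exchange_big [RHS]exchange_big; apply: eq_bigr => a' _ /=.
rewrite exchange_big; apply: eq_bigr => b _; apply: eq_bigr => b' _.
by rewrite !mxE !mxtens_indexK.
Qed.

Variables dA dB dC : nat.
Implicit Types psi : ket R (dA * dB * dC).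

Definition ABC_index (a : 'I_dA) (b : 'I_dB) (c : 'I_dC) : 'I_(dA * dB * dC) :=
  mxtens_index (mxtens_index (a, b), c).

Lemma ABC_index_inj a b c a' b' c' :
  ABC_index a b c = ABC_index a' b' c' -> [/\ a = a', b = b' & c = c'].
Proof.
move=> /(can_inj (@mxtens_indexK _ _))[e ->].
have /(can_inj (@mxtens_indexK _ _))[-> ->] //:
  mxtens_index (a, b) = mxtens_index (a', b') by exact: val_inj.
Qed.

Lemma ptranspose_reducedE psi a b a' b' :
  ptranspose (reduced_AB psi) (mxtens_index (a, b)) (mxtens_index (a', b')) =
  \sum_c psi (ABC_index a b' c) 0 * (psi (ABC_index a' b c) 0)^*%R.
Proof.
rewrite !mxE !mxtens_indexK /=; apply: eq_bigr => c _.
by rewrite mxE big_ord1 !mxE.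
Qed.

Lemma ptranspose_reduced_hermitian psi :
  (ptranspose (reduced_AB psi)) ^t* = ptranspose (reduced_AB psi).
Proof.
apply/matrixP => x y; rewrite -[x]mxtens_unindexK -[y]mxtens_unindexK.
case: (mxtens_unindex x) => a b; case: (mxtens_unindex y) => a' b'.
rewrite mxE mxE !ptranspose_reducedE rmorph_sum; apply: eq_bigr => c _.
by rewrite rmorphM /= conjCK mulrC.
Qed.

(** The state seen as an operator across the cut AB | C; its two Gram matrices are the reduced state
    on AB and, up to conjugation, that on C. *)
Definition amplitude_mx psi : 'M[C]_(dA * dB, dC) :=
  \matrix_(x, c) psi (mxtens_index (x, c)) 0.

Lemma reduced_AB_gram psi :
  reduced_AB psi = amplitude_mx psi *m (amplitude_mx psi) ^t*.
Proof.
apply/matrixP => i j; rewrite !mxE; apply: eq_bigr => c _.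
by rewrite !mxE big_ord1 !mxE.
Qed.

Lemma trace_reduced_AB psi : \sum_i `|psi i 0| ^+ 2 = 1 ->
  complex.Re (\tr (reduced_AB psi)) = 1.
Proof.
move=> h; rewrite -[RHS]/(complex.Re (1 : C)) -h /mxtrace; congr complex.Re.
rewrite [RHS]big_mxtens; apply: eq_bigr => x _; rewrite mxE; apply: eq_bigr => c _.
by rewrite mxE big_ord1 !mxE normCK.
Qed.

(* The purity is bounded below through both Gram matrices of the amplitudes,
   of sizes [dA * dB] and [dC]. *)
Lemma purity_ge psi : \sum_i `|psi i 0| ^+ 2 = 1 ->
  1 <= (dA * dB)%:R * pt_moment 2 (reduced_AB psi) /\
  1 <= dC%:R * pt_moment 2 (reduced_AB psi).
Proof.
move=> h; rewrite /pt_moment trace_ptranspose_sq.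
have h1 := trace_reduced_AB h; move: h1; rewrite reduced_AB_gram.
set V := amplitude_mx psi => h1.
have H (m n : nat) (M : 'M[C]_(m, n)) : (M *m M ^t*) ^t* = M *m M ^t*.
  by rewrite trmx_mul map_mxM /= trmxCK.
split.
  by have := hermitian_trace_sq_ge (H _ _ V); rewrite h1 expr1n.
have := @hermitian_trace_sq_ge _ (V ^t* *m (V ^t*) ^t*) (H _ _ _).
rewrite trmxCK mxtrace_mulC h1 expr1n expr2 -mulmxE mulmxA mxtrace_mulC.
by rewrite !mulmxA expr2 -mulmxE !mulmxA.
Qed.

(** In [ptranspose_reducedE] the row indices [a, b] meet the column indices [a', b'] crosswise. Once
    [b], [b'] and [c] are fixed, an entry splits into a function of the row times a function of the
    column, which gives a factorization through [dB * dB * dC] labels; fixing [a], [a'] and [c]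
    gives the other one. *)
Lemma rank_ptranspose_reduced psi :
  [/\ (\rank (ptranspose (reduced_AB psi)) <= dA * dB)%N,
      (\rank (ptranspose (reduced_AB psi)) <= dB * dB * dC)%N
    & (\rank (ptranspose (reduced_AB psi)) <= dA * dA * dC)%N].
Proof.
split; first exact: rank_leq_row.
  rewrite -[X in (_ <= X)%N](_ : #|{: 'I_dB * 'I_dB * 'I_dC}| = _); last first.
    by rewrite !card_prod !card_ord.
  apply: (@mxrank_factor_le _ _ _ _ _
    (fun x k => psi (ABC_index (mxtens_unindex x).1 k.1.1 k.2) 0 *
                ((mxtens_unindex x).2 == k.1.2)%:R)
    (fun k y => (psi (ABC_index (mxtens_unindex y).1 k.1.2 k.2) 0)^*%R *
                ((mxtens_unindex y).2 == k.1.1)%:R)) => x y.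
  rewrite -[in LHS](mxtens_unindexK x) -[in LHS](mxtens_unindexK y).
  case: (mxtens_unindex x) => a b; case: (mxtens_unindex y) => a' b'.
  rewrite ptranspose_reducedE (eq_bigr (fun k : 'I_dB * 'I_dB * 'I_dC =>
    (fun q c => psi (ABC_index a q.1 c) 0 * (b == q.2)%:R *
      ((psi (ABC_index a' q.2 c) 0)^*%R * (b' == q.1)%:R)) k.1 k.2)) //.
  rewrite -(pair_bigA _ (fun q c => psi (ABC_index a q.1 c) 0 * (b == q.2)%:R *
      ((psi (ABC_index a' q.2 c) 0)^*%R * (b' == q.1)%:R))) /=.
  (* The Kronecker deltas leave only the label with [q.1 = b'] and [q.2 = b]. *)
  rewrite (bigD1 (b', b)) //= [X in _ + X]big1 ?addr0.
    by apply: eq_bigr => c _; rewrite !eqxx !mulr1.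
  move=> [b1 b2]; rewrite xpair_eqE negb_and => ne; rewrite big1 // => c _ /=.
  rewrite [b' == b1]eq_sym [b == b2]eq_sym.
  by case/orP: ne => /negPf ->; rewrite !(mulr0, mul0r).
rewrite -[X in (_ <= X)%N](_ : #|{: 'I_dA * 'I_dA * 'I_dC}| = _); last first.
  by rewrite !card_prod !card_ord.
apply: (@mxrank_factor_le _ _ _ _ _
  (fun x k => (psi (ABC_index k.1.1 (mxtens_unindex x).2 k.2) 0)^*%R *
              ((mxtens_unindex x).1 == k.1.2)%:R)
  (fun k y => psi (ABC_index k.1.2 (mxtens_unindex y).2 k.2) 0 *
              ((mxtens_unindex y).1 == k.1.1)%:R)) => x y.
rewrite -[in LHS](mxtens_unindexK x) -[in LHS](mxtens_unindexK y).
case: (mxtens_unindex x) => a b; case: (mxtens_unindex y) => a' b'.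
rewrite ptranspose_reducedE (eq_bigr (fun k : 'I_dA * 'I_dA * 'I_dC =>
  (fun q c => (psi (ABC_index q.1 b c) 0)^*%R * (a == q.2)%:R *
    (psi (ABC_index q.2 b' c) 0 * (a' == q.1)%:R)) k.1 k.2)) //.
rewrite -(pair_bigA _ (fun q c => (psi (ABC_index q.1 b c) 0)^*%R * (a == q.2)%:R *
    (psi (ABC_index q.2 b' c) 0 * (a' == q.1)%:R))) /=.
rewrite (bigD1 (a', a)) //= [X in _ + X]big1 ?addr0.
  by apply: eq_bigr => c _; rewrite !eqxx !mulr1 mulrC.
move=> [a1 a2]; rewrite xpair_eqE negb_and => ne; rewrite big1 // => c _ /=.
rewrite [a' == a1]eq_sym [a == a2]eq_sym.
by case/orP: ne => /negPf ->; rewrite !(mulr0, mul0r).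
Qed.

End ReducedState.

(** * The fourth moment as a sum of monomials, and its control of the negativities *)

(** The trace sums over closed walks of length four, encoded as functions on the cyclic set ['I_4]
    with successor [ordS]. *)
Lemma trace_pow4_ffun (F : comPzRingType) n (A : 'M[F]_n) :
  \tr (A ^+ 4) = \sum_(i : {ffun 'I_4 -> 'I_n}) \prod_t A (i t) (i (ordS t)).
Proof.
pose h (q : 'I_n * 'I_n * ('I_n * 'I_n)) : {ffun 'I_4 -> 'I_n} :=
  [ffun t : 'I_4 => tnth [tuple q.1.1; q.1.2; q.2.1; q.2.2] t].
have h_bij : bijective h.
  exists (fun i : {ffun 'I_4 -> 'I_n} =>
    ((i (inord 0), i (inord 1)), (i (inord 2), i (inord 3)))).
    by move=> [[x y] [z w]]; rewrite !ffunE !(tnth_nth x) /= !inordK.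
  move=> i; apply/ffunP => t; rewrite ffunE (tnth_nth (i t)) /=.
  case: t => -[|[|[|[|//]]]] lt_t /=; congr (i _); apply: val_inj => /=;
    by rewrite inordK.
rewrite (reindex _ (onW_bij _ h_bij)) /=.
rewrite (eq_bigr (fun q : 'I_n * 'I_n * ('I_n * 'I_n) =>
  (fun u v => A u.1 u.2 * (A u.2 v.1 * (A v.1 v.2 * A v.2 u.1))) q.1 q.2)); last first.
  move=> [[x y] [z w]] _; rewrite !big_ord_recl big_ord0 /= mulr1 !ffunE.
  by rewrite !(tnth_nth x) /=.
rewrite -(pair_bigA _ (fun u v : 'I_n * 'I_n =>
  A u.1 u.2 * (A u.2 v.1 * (A v.1 v.2 * A v.2 u.1)))) /=.
rewrite -(pair_bigA _ (fun u1 u2 => \sum_(v : 'I_n * 'I_n)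
  (A u1 u2 * (A u2 v.1 * (A v.1 v.2 * A v.2 u1))))) /=.
rewrite (exprM A 2 2) 2!expr2 -!mulmxE /mxtrace; apply: eq_bigr => x _; rewrite mxE.
rewrite (eq_bigr (fun z => \sum_y \sum_w (A x y * (A y z * (A z w * A w x))))).
  rewrite exchange_big; apply: eq_bigr => y _.
  by rewrite -(pair_bigA _ (fun z w => A x y * (A y z * (A z w * A w x)))).
move=> z _; rewrite !mxE mulr_suml; apply: eq_bigr => y _.
by rewrite mulr_sumr; apply: eq_bigr => w _; rewrite -mulrA.
Qed.

Section FourthMoment.
Variable R : realType.
Local Notation C := R[i].

(** A matrix entry of the fourth tensor power of the projector on [psi]. *)
Definition moment_monomial D (i j : 'I_4 -> 'I_D) (psi : ket R D) : C :=
  \prod_t (psi (i t) 0 * (psi (j t) 0)^*%R).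

Variables dA dB dC : nat.

(** The product along a closed walk shifts the indices of A cyclically; the partial transposition
    reverses the shift on B, and the trace over C leaves its indices unshifted. These three patterns
    produce the permutations [t s], [t^-1 s] and [s]. *)
Lemma pt_moment4E (psi : ket R (dA * dB * dC)) :
  pt_moment 4 (reduced_AB psi) =
  \sum_(a : {ffun 'I_4 -> 'I_dA}) \sum_(b : {ffun 'I_4 -> 'I_dB})
  \sum_(c : {ffun 'I_4 -> 'I_dC})
    complex.Re (moment_monomial
      (fun t => ABC_index (a t) (b (ordS t)) (c t))
      (fun t => ABC_index (a (ordS t)) (b t) (c t)) psi).
Proof.
rewrite /pt_moment trace_pow4_ffun.
pose h (q : {ffun 'I_4 -> 'I_dA} * {ffun 'I_4 -> 'I_dB}) : {ffun 'I_4 -> 'I_(dA * dB)} :=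
  [ffun t => mxtens_index (q.1 t, q.2 t)].
have h_bij : bijective h.
  exists (fun i : {ffun 'I_4 -> 'I_(dA * dB)} =>
    ([ffun t => (mxtens_unindex (i t)).1], [ffun t => (mxtens_unindex (i t)).2])).
    by move=> [a b]; congr (_, _); apply/ffunP => t; rewrite !ffunE mxtens_indexK.
  by move=> i; apply/ffunP => t; rewrite !ffunE -surjective_pairing mxtens_unindexK.
rewrite (reindex _ (onW_bij _ h_bij)) /=.
rewrite raddf_sum pair_bigA; apply: eq_bigr => -[a b] _ /=.
rewrite -raddf_sum; congr complex.Re.
under eq_bigr do rewrite !ffunE ptranspose_reducedE.
by rewrite bigA_distr_bigA.
Qed.

(** Concavity: the graph of [ln] lies below its tangent at [q]. *)
Lemma ln_le_affine (q x : R) : 0 < q -> 0 < x -> ln x <= ln q + (x / q - 1).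
Proof.
move=> q0 x0; rewrite -lerBlDl -ln_div ?posrE //.
have xq : 0 < x / q by rewrite divr_gt0.
by have := @le_ln1Dx R (x / q - 1); rewrite addrCA addrN addr0; apply; lra.
Qed.

(* Both negativities are squeezed between affine functions of [p_4], so that
   only the mean of [p_4] matters: [p_2 >= 1/m] bounds [E_4] from below,
   Hoelder's inequality gives [E_4 <= E], the rank bounds [E] from above, and
   [ln p_4] is replaced by its tangent at [q]. *)
Lemma negativity_squeeze (psi : ket R (dA * dB * dC)) (m r : nat) (q : R) :
  0 < q ->
  \sum_i `|psi i 0| ^+ 2 = 1 ->
  1 <= m%:R * pt_moment 2 (reduced_AB psi) ->
  (\rank (ptranspose (reduced_AB psi)) <= r)%N ->
  let p4 := pt_moment 4 (reduced_AB psi) in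
  [/\ - (3 / 2) * ln m%:R - 2^-1 * (ln q - 1) - (2 * q)^-1 * p4
        <= log_negativity4 (reduced_AB psi),
      log_negativity4 (reduced_AB psi) <= log_negativity (reduced_AB psi)
    & log_negativity (reduced_AB psi) <=
        3 / 4 * ln r%:R + 4^-1 * (ln q - 1) + (4 * q)^-1 * p4].
Proof.
move=> q0 psi1 hm hr /=.
have herm := ptranspose_reduced_hermitian psi.
have := trace_norm_holder herm; have := trace_norm_rank herm hr.
have := trace_norm_ge0 herm; have := hermitian_trace_pow4_gt0 herm.
rewrite /log_negativity /log_negativity4; move: hm; rewrite /pt_moment.
set p2 := complex.Re (\tr (_ ^+ 2)); set p4 := complex.Re _; set tn := trace_norm _.
clearbody p2 p4 tn.
move=> hm p4_gt0 tn0 h_rank h_holder.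
have m0 : 0 < m%:R :> R.
  by rewrite ltr0n lt0n; apply: contraTneq hm => ->; rewrite mul0r ler10.
have p20 : 0 < p2 by rewrite -(pmulr_rgt0 _ m0) (lt_le_trans ltr01).
have {p4_gt0} p40 : 0 < p4 := p4_gt0 p20.
have tn_gt0 : 0 < tn.
  rewrite lt_def tn0 andbT; apply: contraTneq h_holder => ->.
  by rewrite expr0n mul0r -ltNge exprn_gt0.
have r0 : 0 < r%:R :> R.
  rewrite ltr0n lt0n; apply: contraTneq h_rank => ->.
  by rewrite expr0n mul0r -ltNge exprn_gt0.
have lnE (x : R) k : 0 < x -> ln (x ^+ k) = k%:R * ln x.
  by move=> x0; rewrite lnXn // mulr_natl.
have lnp4 := ln_le_affine q0 p40.
have Eq k : (k * q)^-1 * p4 = k^-1 * (p4 / q) by rewrite invfM; ring.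
have ln_ratio : ln (p2 ^+ 3 / p4) = 3 * ln p2 - ln p4.
  by rewrite ln_div ?posrE ?exprn_gt0 // lnE.
rewrite ln_ratio !Eq; split.
- have : 0 <= ln m%:R + ln p2 by rewrite -lnM ?posrE // ln_ge0.
  lra.
- have : ln (p2 ^+ 3) <= ln (tn ^+ 2 * p4).
    by rewrite ler_ln ?posrE ?mulr_gt0 ?exprn_gt0.
  rewrite [ln (_ * p4)]lnM ?posrE ?exprn_gt0 // !lnE //; lra.
- have : ln (tn ^+ 4) <= ln (r%:R ^+ 3 * p4).
    by rewrite ler_ln ?posrE ?mulr_gt0 ?exprn_gt0.
  rewrite [ln (_ * p4)]lnM ?posrE ?exprn_gt0 // !lnE //; lra.
Qed.

End FourthMoment.

(** * Averages over ensembles of pure states *)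

Section Sandwich.
Context d (T : measurableType d) (R : realType).
Variable mu : {measure set T -> \bar R}.
Variable S : set T.
Hypotheses (mS : measurable S) (S1 : mu (~` S) = 0%E).

Let setDC : [set: T] `\` ~` S = S.
Proof. by rewrite setDE setTI setCK. Qed.

Let integral_conull (f : T -> \bar R) : measurable_fun setT f ->
  (forall x, 0 <= f x)%E -> (\int[mu]_x f x = \int[mu]_(x in S) f x)%E.
Proof.
move=> mf f0; rewrite (@ge0_negligible_integral _ _ _ mu setT (~` S)) ?setDC //.
exact: measurableC.
Qed.

Import HBNNSimple.

(** The integral of [f] is a supremum over simple functions [h <= f]. Each [h] is measurable, so it
    can be compared with [g] on [S] alone. *)
Let integral_le_measurable_r (f g : T -> \bar R) :
  (forall x, 0 <= f x)%E -> (forall x, 0 <= g x)%E -> measurable_fun setT g ->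
  (forall x, S x -> f x <= g x)%E -> (\int[mu]_x f x <= \int[mu]_x g x)%E.
Proof.
move=> f0 g0 mg fg; rewrite [leLHS]ge0_integralTE //.
apply: ge_ereal_sup => _ [h /= hf <-].
have <- : (\int[mu]_x (h x)%:E)%E = sintegral mu h by rewrite integral_nnsfun // patch_setT.
have mh : measurable_fun setT (EFin \o h) by exact/measurable_EFinP.
rewrite (integral_conull mh) ?(integral_conull mg) // => [|x]; last by rewrite lee_fin.
apply: ge0_le_integral => //.
- by move=> x _; rewrite lee_fin.
- exact: measurable_funTS.
- exact: measurable_funTS.
- by move=> x Sx; apply: le_trans (fg _ Sx); exact: hf.
Qed.

(** Here [f] is measurable and may be set to 0 off [S]; every simple function below this restriction
    is then below [g] everywhere. *)
Let integral_le_measurable_l (f g : T -> \bar R) :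
  (forall x, 0 <= f x)%E -> (forall x, 0 <= g x)%E -> measurable_fun setT f ->
  (forall x, S x -> f x <= g x)%E -> (\int[mu]_x f x <= \int[mu]_x g x)%E.
Proof.
move=> f0 g0 mf fg; rewrite integral_conull // integral_mkcond.
have fS0 x : (0 <= (f \_ S) x)%E by rewrite /patch; case: ifP.
rewrite !ge0_integralTE //; apply: le_ereal_sup => _ [h /= hf <-].
exists h => //= x; apply: le_trans (hf x) _; rewrite /patch.
by case: ifP => // /set_mem /fg.
Qed.

(* [f] need not be measurable: the library integral is a lower integral of
   positive and negative parts, which is monotone. *)
Lemma Rintegral_sandwich (l f u : T -> R) :
  mu.-integrable setT (EFin \o l) -> mu.-integrable setT (EFin \o u) ->
  (forall x, S x -> l x <= f x <= u x) ->
  \int[mu]_x l x <= \int[mu]_x f x <= \int[mu]_x u x.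
Proof.
move=> il iu lfu.
have [ml _] := integrableP _ _ _ il; have [mv _] := integrableP _ _ _ iu.
have fin_p (g : T -> R) : mu.-integrable setT (EFin \o g) ->
    (\int[mu]_x (EFin \o g)^\+ x)%E \is a fin_num.
  by move=> ig; apply: integrable_fin_num => //; exact: integrable_funepos.
have fin_n (g : T -> R) : mu.-integrable setT (EFin \o g) ->
    (\int[mu]_x (EFin \o g)^\- x)%E \is a fin_num.
  by move=> ig; apply: integrable_fin_num => //; exact: integrable_funeneg.
have lf x : S x -> ((EFin \o l) x <= (EFin \o f) x)%E.
  by move=> /lfu /andP[]; rewrite lee_fin.
have fu x : S x -> ((EFin \o f) x <= (EFin \o u) x)%E.
  by move=> /lfu /andP[]; rewrite lee_fin.
have p_mono (g h : T -> \bar R) x : (g x <= h x)%E -> (g^\+ x <= h^\+ x)%E.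
  by move=> gh; rewrite !funeposE ge_max !le_max lexx gh orbT.
have n_mono (g h : T -> \bar R) x : (g x <= h x)%E -> (h^\- x <= g^\- x)%E.
  by move=> gh; rewrite !funenegE ge_max !le_max lexx leeN2 gh orbT.
have P1 : (\int[mu]_x (EFin \o l)^\+ x <= \int[mu]_x (EFin \o f)^\+ x)%E.
  apply: integral_le_measurable_l => // [|x /lf/p_mono //].
  exact: measurable_funepos.
have P2 : (\int[mu]_x (EFin \o f)^\+ x <= \int[mu]_x (EFin \o u)^\+ x)%E.
  apply: integral_le_measurable_r => // [|x /fu/p_mono //].
  exact: measurable_funepos.
have N1 : (\int[mu]_x (EFin \o f)^\- x <= \int[mu]_x (EFin \o l)^\- x)%E.
  apply: integral_le_measurable_r => // [|x /lf/n_mono //].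
  exact: measurable_funeneg.
have N2 : (\int[mu]_x (EFin \o u)^\- x <= \int[mu]_x (EFin \o f)^\- x)%E.
  apply: integral_le_measurable_l => // [|x /fu/n_mono //].
  exact: measurable_funeneg.
have Fp : (\int[mu]_x (EFin \o f)^\+ x)%E \is a fin_num.
  rewrite ge0_fin_numE; last by apply: integral_ge0.
  by apply: le_lt_trans P2 _; rewrite -ge0_fin_numE ?fin_p //; apply: integral_ge0.
have Fn : (\int[mu]_x (EFin \o f)^\- x)%E \is a fin_num.
  rewrite ge0_fin_numE; last by apply: integral_ge0.
  by apply: le_lt_trans N1 _; rewrite -ge0_fin_numE ?fin_n //; apply: integral_ge0.
have RE (g : T -> R) : \int[mu]_x g x =
    fine (\int[mu]_x (EFin \o g)^\+ x - \int[mu]_x (EFin \o g)^\- x)%E.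
  by rewrite /Rintegral integralE.
rewrite !RE; apply/andP; split; apply: fine_le.
- by rewrite fin_numB fin_p // fin_n.
- by rewrite fin_numB Fp Fn.
- exact: leeB.
- by rewrite fin_numB Fp Fn.
- by rewrite fin_numB fin_p // fin_n.
- exact: leeB.
Qed.

End Sandwich.

(** * Measurability of complex-valued functions *)

Section ComplexMeasurable.
Context d (T : measurableType d) (R : realType).
Local Notation C := R[i].

Definition complex_measurable (f : T -> C) :=
  measurable_fun setT (fun x => complex.Re (f x)) /\
  measurable_fun setT (fun x => complex.Im (f x)).

Lemma complex_measurable_cst (z : C) : complex_measurable (fun=> z).
Proof. by split; exact: measurable_cst. Qed.

Lemma complex_measurableD f g : complex_measurable f -> complex_measurable g ->
  complex_measurable (fun x => f x + g x).
Proof.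
move=> [f1 f2] [g1 g2]; split.
  under eq_fun do rewrite raddfD; exact: measurable_funD.
under eq_fun do rewrite raddfD; exact: measurable_funD.
Qed.

Lemma complex_measurableM f g : complex_measurable f -> complex_measurable g ->
  complex_measurable (fun x => f x * g x).
Proof.
move=> [f1 f2] [g1 g2]; split.
  rewrite (_ : (fun x => _) = fun x => complex.Re (f x) * complex.Re (g x) -
    complex.Im (f x) * complex.Im (g x)).
    by apply: measurable_funB; exact: measurable_funM.
  by apply/funext => x; case: (f x) (g x) => a b [].
rewrite (_ : (fun x => _) = fun x => complex.Re (f x) * complex.Im (g x) +
  complex.Im (f x) * complex.Re (g x)).
  by apply: measurable_funD; exact: measurable_funM.
by apply/funext => x; case: (f x) (g x) => a b [].
Qed.

Lemma complex_measurable_conj f : complex_measurable f ->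
  complex_measurable (fun x => (f x)^*%R).
Proof.
move=> [f1 f2]; split.
  by rewrite (_ : (fun x => _) = fun x => complex.Re (f x)) //;
    apply/funext => x; case: (f x).
rewrite (_ : (fun x => _) = fun x => - complex.Im (f x)); first exact: measurable_funN.
by apply/funext => x; case: (f x).
Qed.

Lemma complex_measurable_sum I (s : seq I) (P : pred I) (f : I -> T -> C) :
  (forall i, complex_measurable (f i)) ->
  complex_measurable (fun x => \sum_(i <- s | P i) f i x).
Proof.
move=> mf; elim: s => [|i s IH].
  by under eq_fun do rewrite big_nil; exact: complex_measurable_cst.
under eq_fun do rewrite big_cons; case: (P i) => //; exact: complex_measurableD.
Qed.

Lemma complex_measurable_prod I (s : seq I) (P : pred I) (f : I -> T -> C) :
  (forall i, complex_measurable (f i)) ->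
  complex_measurable (fun x => \prod_(i <- s | P i) f i x).
Proof.
move=> mf; elim: s => [|i s IH].
  by under eq_fun do rewrite big_nil; exact: complex_measurable_cst.
under eq_fun do rewrite big_cons; case: (P i) => //; exact: complex_measurableM.
Qed.

End ComplexMeasurable.

(** * Measurability on the space of vectors, and integrability over unit vectors *)

Section Kets.
Variables (R : realType) (D : nat).
Local Notation C := R[i].
Implicit Types psi : ket R D.

Lemma measurable_amplitude (i : 'I_D) : measurable_fun setT (@amplitude R D i).
Proof.
move=> _ A mA; rewrite setTI; apply: sub_sigma_algebra.
by rewrite (bigD1 i) //=; left; exists A => //; rewrite setTI.
Qed.

Lemma measurable_fun_ket d (T : measurableType d) (f : T -> ket R D) :
  (forall i, measurable_fun setT (@amplitude R D i \o f)) ->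
  measurable_fun setT f.
Proof.
move=> mf; apply: (measurability _ (erefl : @measurable _ (ket R D) = _)).
move=> _ [A GA <-]; move: A GA.
apply: (big_ind (fun G : set (set (ket R D)) =>
  forall A, G A -> measurable ([set: T] `&` f @^-1` A))) => //.
- by move=> G1 G2 h1 h2 A [/h1|/h2].
- move=> i _ _ [A mA <-]; rewrite setTI.
  have := mf i measurableT A mA; rewrite !setTI.
  by rewrite comp_preimage.
Qed.

Lemma complex_measurable_coord (i : 'I_D) :
  complex_measurable (fun psi : ket R D => psi i 0).
Proof.
split.
  exact: (measurableT_comp measurable_fst (measurable_amplitude i)).
exact: (measurableT_comp measurable_snd (measurable_amplitude i)).
Qed.

Lemma measurable_mulmx (U : 'M[C]_D) :
  measurable_fun setT (fun psi : ket R D => (U *m psi : ket R D)).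
Proof.
apply: measurable_fun_ket => i; rewrite /amplitude /=.
have [mr mi] : complex_measurable (fun psi : ket R D => (U *m psi) i 0).
  under eq_fun do rewrite mxE; apply: complex_measurable_sum => j.
  apply: complex_measurableM; first exact: complex_measurable_cst.
  exact: complex_measurable_coord.
exact: measurable_fun_pair.
Qed.

Definition unit_ket : set (ket R D) :=
  [set psi | \sum_(i < D) `|psi i ord0| ^+ 2 = 1].

Lemma measurable_unit_ket : measurable unit_ket.
Proof.
(* The squared norm is a nonnegative real inside [C], so the unit condition is an equation for the
   real function [N]. *)
pose N (psi : ket R D) := complex.Re (\sum_(i < D) psi i 0 * (psi i 0)^*%R).
have mN : measurable_fun setT N.
  have [] // : complex_measurable (fun psi : ket R D => \sum_(i < D) psi i 0 * (psi i 0)^*%R).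
  apply: complex_measurable_sum => i; apply: complex_measurableM.
    exact: complex_measurable_coord.
  exact/complex_measurable_conj/complex_measurable_coord.
rewrite (_ : unit_ket = N @^-1` [set 1]).
  by rewrite -[X in measurable X]setTI; apply: mN => //; exact: measurable_set1.
apply/seteqP; split=> psi; rewrite /unit_ket /N /=.
  by under eq_bigr do rewrite normCK; move=> ->.
under [in X in _ -> X]eq_bigr do rewrite normCK.
move=> h; rewrite (@Re_ge0_complex R (\sum_(i < D) _)) ?h //.
by apply: sumr_ge0 => i _; rewrite -normCK exprn_ge0.
Qed.

Lemma unit_ket_le1 psi i : unit_ket psi -> `|psi i 0| <= 1.
Proof.
move=> h; rewrite -(@expr_le1 _ 2) // -h (bigD1 i) //= lerDl.
by apply: sumr_ge0 => j _; rewrite exprn_ge0.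
Qed.

Variable nu : probability (ket R D) R.
Hypothesis nu_pure : pure_ensemble nu.

Lemma pure_ensembleC : nu (~` unit_ket) = 0%E.
Proof.
rewrite probability_setC; last exact: measurable_unit_ket.
by rewrite [X in (_ - X)%E]nu_pure subee.
Qed.

Lemma pure_integrable (f : ket R D -> R) (K : R) : measurable_fun setT f ->
  (forall psi, unit_ket psi -> `|f psi| <= K) ->
  nu.-integrable setT (EFin \o f).
Proof.
move=> mf fK.
have mS := measurable_unit_ket.
apply/(@negligible_integrable _ _ _ nu setT (~` unit_ket) _ (measurableC mS)) => //.
- exact/measurable_EFinP.
- exact: pure_ensembleC.
- rewrite setDE setTI setCK; apply: measurable_bounded_integrable => //.
  + by rewrite (le_lt_trans (probability_le1 _ _)) ?ltry.
  + exact: measurable_funTS.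
  + exists K; split; first exact: num_real.
    by move=> M KM psi /fK /le_trans; apply; exact: ltW.
Qed.

End Kets.

Section Averages.
Variables (R : realType) (D : nat).
Local Notation C := R[i].

(** A class closed under sums and products whose members are integrable for every ensemble of pure
    states; boundedness is asked on unit vectors only, so that polynomials in the amplitudes belong
    to it. *)
Definition tame (f : ket R D -> R) := measurable_fun setT f /\
  exists K, forall psi, unit_ket psi -> `|f psi| <= K.

Lemma tame_cst (k : R) : tame (fun=> k).
Proof. by split; [exact: measurable_cst|exists `|k|]. Qed.

Lemma tameD f g : tame f -> tame g -> tame (fun psi => f psi + g psi).
Proof.
move=> [mf [K fK]] [mg [L gL]]; split; first exact: measurable_funD.
by exists (K + L) => psi h; rewrite (le_trans (ler_normD _ _)) // lerD ?fK ?gL.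
Qed.

Lemma tameM f g : tame f -> tame g -> tame (fun psi => f psi * g psi).
Proof.
move=> [mf [K fK]] [mg [L gL]]; split; first exact: measurable_funM.
by exists (K * L) => psi h; rewrite normrM ler_pM ?fK ?gL.
Qed.

Lemma tameZ (k : R) f : tame f -> tame (fun psi => k * f psi).
Proof. exact/tameM/tame_cst. Qed.

Lemma tameZr f (k : R) : tame f -> tame (fun psi => f psi * k).
Proof. by move=> tf; exact/tameM/tame_cst. Qed.

Lemma tameX k f : tame f -> tame (fun psi => f psi ^+ k).
Proof.
move=> tf; elim: k => [|k IH]; first by under eq_fun do rewrite expr0; exact: tame_cst.
by under eq_fun do rewrite exprS; exact: tameM.
Qed.

Lemma tame_sum I (s : seq I) (f : I -> ket R D -> R) : (forall i, tame (f i)) ->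
  tame (fun psi => \sum_(i <- s) f i psi).
Proof.
move=> tf; elim: s => [|i s IH].
  by under eq_fun do rewrite big_nil; exact: tame_cst.
by under eq_fun do rewrite big_cons; exact: tameD.
Qed.

Variable nu : probability (ket R D) R.
Hypothesis nu_pure : pure_ensemble nu.

Lemma tame_integrable f : tame f -> nu.-integrable setT (EFin \o f).
Proof. by move=> [mf [K fK]]; exact: pure_integrable fK. Qed.

Lemma average_cst (k : R) : average nu (fun=> k) = k.
Proof.
by rewrite /average Rintegral_cst // [X in fine X]probability_setT mulr1.
Qed.

Lemma averageD f g : tame f -> tame g ->
  average nu (fun psi => f psi + g psi) = average nu f + average nu g.
Proof. by move=> tf tg; apply: RintegralD => //; exact: tame_integrable. Qed.

Lemma averageZ (k : R) f : tame f ->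
  average nu (fun psi => k * f psi) = k * average nu f.
Proof. by move=> tf; apply: RintegralZl => //; exact: tame_integrable. Qed.

Lemma average_sum I (s : seq I) (f : I -> ket R D -> R) : (forall i, tame (f i)) ->
  average nu (fun psi => \sum_(i <- s) f i psi) = \sum_(i <- s) average nu (f i).
Proof.
move=> tf; elim: s => [|i s IH].
  by rewrite big_nil; under eq_fun do rewrite big_nil; exact: average_cst.
rewrite big_cons -IH -averageD //; last exact: tame_sum.
by congr average; apply/funext => psi; rewrite big_cons.
Qed.

Lemma average_sandwich (l f u : ket R D -> R) : tame l -> tame u ->
  (forall psi, unit_ket psi -> l psi <= f psi <= u psi) ->
  average nu l <= average nu f <= average nu u.
Proof.
move=> tl tu; apply: Rintegral_sandwich.
- exact: measurable_unit_ket.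
- exact: pure_ensembleC.
- exact: tame_integrable.
- exact: tame_integrable.
Qed.

Lemma le_average f g : tame f -> tame g ->
  (forall psi, unit_ket psi -> f psi <= g psi) -> average nu f <= average nu g.
Proof.
move=> tf tg fg.
by case/andP: (@average_sandwich f g g tf tg (fun psi h => introT andP (conj (fg psi h) (lexx _)))).
Qed.

Lemma eq_average f g : tame f -> tame g ->
  (forall psi, unit_ket psi -> f psi = g psi) -> average nu f = average nu g.
Proof.
by move=> tf tg fg; apply/eqP; rewrite eq_le !le_average // => psi /fg ->.
Qed.

End Averages.

(** * Weights and monomials of the amplitudes *)

Section Monomials.
Variables (R : realType) (D : nat).
Local Notation C := R[i].

Definition weight (i : 'I_D) (psi : ket R D) : R := complex.Re (`|psi i 0| ^+ 2).

Lemma weightE i psi : weight i psi =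
  complex.Re (psi i 0) ^+ 2 + complex.Im (psi i 0) ^+ 2.
Proof. exact: Re_sqr_norm. Qed.

Lemma weight_ge0 i psi : 0 <= weight i psi.
Proof. by rewrite weightE addr_ge0 ?sqr_ge0. Qed.

Lemma sum_weight psi : unit_ket psi -> \sum_i weight i psi = 1.
Proof. by move=> h; rewrite -raddf_sum h. Qed.

Lemma weight_le1 i psi : unit_ket psi -> weight i psi <= 1.
Proof.
move=> /sum_weight <-; rewrite (bigD1 i) //= lerDl.
by apply: sumr_ge0 => j _; exact: weight_ge0.
Qed.

Lemma tame_weight i : tame (@weight i).
Proof.
split; last by exists 1 => psi h; rewrite ger0_norm ?weight_ge0 ?weight_le1.
have [mr mi] := complex_measurable_coord R i.
rewrite (_ : weight i = fun psi => complex.Re (psi i 0) ^+ 2 + complex.Im (psi i 0) ^+ 2);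
  last by apply/funext => psi; exact: weightE.
by apply: measurable_funD; exact: measurable_funX.
Qed.

(** Half the interference term of [|psi_i + psi_j|^2]. *)
Definition overlap (i j : 'I_D) (psi : ket R D) : R :=
  complex.Re (psi i 0 * (psi j 0)^*%R).

Lemma normc_ler1 (z : C) : `|z| <= 1 ->
  `|complex.Re z| <= 1 /\ `|complex.Im z| <= 1.
Proof.
move=> z1; have : complex.Re (`|z| ^+ 2) <= 1.
  have : `|z| ^+ 2 <= 1 by rewrite expr_le1.
  by case: (_ ^+ 2) => x y; rewrite lecE /= => /andP[].
rewrite Re_sqr_norm => h; split; rewrite -(@expr_le1 _ 2) // real_normK ?num_real //.
  by apply: le_trans h; rewrite lerDl sqr_ge0.
by apply: le_trans h; rewrite lerDr sqr_ge0.
Qed.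

Lemma complex_tame (f : ket R D -> C) : complex_measurable f ->
  (forall psi, unit_ket psi -> `|f psi| <= 1) ->
  tame (fun psi => complex.Re (f psi)) /\ tame (fun psi => complex.Im (f psi)).
Proof.
by move=> [mr mi] f1; split; split=> //; exists 1 => psi /f1/normc_ler1[].
Qed.

Lemma tame_overlap i j : tame (overlap i j).
Proof.
have [] // := @complex_tame (fun psi => psi i 0 * (psi j 0)^*%R).
  by apply: complex_measurableM; [|apply: complex_measurable_conj];
    exact: complex_measurable_coord.
by move=> psi h; rewrite normrM norm_conjC mulr_ile1 ?unit_ket_le1.
Qed.

Lemma overlap_sqr_le i j psi :
  overlap i j psi ^+ 2 <= weight i psi * weight j psi.
Proof.
rewrite /overlap !weightE; case: (psi i 0) (psi j 0) => a b [a' b'] /=.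
have : 0 <= (a * b' - b * a') ^+ 2 by rewrite sqr_ge0.
nra.
Qed.

Lemma tame_monomial (i j : 'I_4 -> 'I_D) :
  tame (fun psi : ket R D => complex.Re (moment_monomial i j psi)) /\
  tame (fun psi : ket R D => complex.Im (moment_monomial i j psi)).
Proof.
apply: complex_tame.
  apply: complex_measurable_prod => t.
  by apply: complex_measurableM; [|apply: complex_measurable_conj];
    exact: complex_measurable_coord.
move=> psi h; rewrite normr_prod -[leRHS](@big1_eq _ _ (@GRing.mul C) _ (index_enum 'I_4) xpredT).
apply: ler_prod => t _; rewrite normr_ge0 normrM norm_conjC.
by rewrite mulr_ile1 ?unit_ket_le1.
Qed.

(** The modulus of the monomial is the product of the four numbers [u t]. The arithmetic-geometric
    mean inequality gives a factor 1/4, and splitting each [u t ^+ 4] gives a further 1/2. *)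
Lemma monomial_le_weights (i j : 'I_4 -> 'I_D) psi :
  complex.Re (moment_monomial i j psi) <=
  8^-1 * \sum_t (weight (i t) psi ^+ 4 + weight (j t) psi ^+ 4).
Proof.
pose u t := Num.sqrt (weight (i t) psi * weight (j t) psi).
have u0 t : 0 <= u t by exact: sqrtr_ge0.
have u4 t : u t ^+ 4 <= 2^-1 * (weight (i t) psi ^+ 4 + weight (j t) psi ^+ 4).
  rewrite (exprM _ 2 2) sqr_sqrtr ?mulr_ge0 ?weight_ge0 //.
  have : 0 <= (weight (i t) psi ^+ 2 - weight (j t) psi ^+ 2) ^+ 2 by rewrite sqr_ge0.
  by lra.
have amgm (x y z w : R) : x * (y * (z * w)) <= 4^-1 * (x ^+ 4 + (y ^+ 4 + (z ^+ 4 + w ^+ 4))).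
  have : 0 <= (x * y - z * w) ^+ 2 by rewrite sqr_ge0.
  have : 0 <= (x ^+ 2 - y ^+ 2) ^+ 2 by rewrite sqr_ge0.
  have : 0 <= (z ^+ 2 - w ^+ 2) ^+ 2 by rewrite sqr_ge0.
  by lra.
apply: (@le_trans _ _ (\prod_t u t)).
  have -> : \prod_t u t = complex.Re `|moment_monomial i j psi|.
    rewrite normr_prod -[LHS]/(complex.Re (\prod_t u t)%:C) rmorph_prod.
    congr complex.Re; apply: eq_bigr => t _.
    rewrite normrM norm_conjC.
    have n0 : 0 <= `|psi (i t) 0| * `|psi (j t) 0| by rewrite mulr_ge0 ?normr_ge0.
    have v0 : 0 <= (u t)%:C by rewrite lecR.
    apply/eqP; rewrite -(eqrXn2 (isT : 0 < 2)%N v0 n0); apply/eqP.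
    rewrite -rmorphXn sqr_sqrtr ?mulr_ge0 ?weight_ge0 // exprMn.
    by rewrite rmorphM /= /weight -!Re_ge0_complex ?exprn_ge0.
  rewrite (le_trans (ler_norm _)) // -lecR -Re_ge0_complex //.
  exact: normc_ge_Re.
apply: (@le_trans _ _ (4^-1 * \sum_t u t ^+ 4)).
  by rewrite !big_ord_recl !big_ord0 mulr1 addr0; exact: amgm.
rewrite (_ : 8^-1 = 4^-1 * 2^-1); last by field.
rewrite -mulrA ler_wpM2l ?invr_ge0 // mulr_sumr.
by apply: ler_sum => t _; exact: u4.
Qed.

End Monomials.

(** * Moments of the Haar measure *)

Section Haar.
Variables (R : realType) (D : nat).
Local Notation C := R[i].

Lemma conjC_real (x : R) : (x%:C)^*%R = x%:C :> C.
Proof. exact: conjc_real. Qed.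

Lemma unitary_unit_ket (U : 'M[C]_D) (psi : ket R D) : U \is unitarymx ->
  unit_ket psi -> unit_ket (U *m psi).
Proof.
have E (v : ket R D) : \sum_(i < D) `|v i ord0| ^+ 2 = (v ^t* *m v) 0 0.
  by rewrite mxE; apply: eq_bigr => i _; rewrite !mxE normCKC.
rewrite /unit_ket /= !E => uU.
rewrite trmx_mul map_mxM /= mulmxA -[_ *m _ *m U]mulmxA.
by rewrite -invmx_unitary // mulVmx ?unitarymx_unit // mulmx1.
Qed.

Variable mu : probability (ket R D) R.
Hypothesis mu_haar : haar mu.
Let mu_pure : pure_ensemble mu := mu_haar.1.

Lemma haar_average (U : 'M[C]_D) (f : ket R D -> R) : U \is unitarymx -> tame f ->
  average mu (fun psi => f (U *m psi)) = average mu f.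
Proof.
move=> uU tf; have mU := measurable_mulmx U; have mf := tf.1.
have tfU : tame (fun psi : ket R D => f (U *m psi : ket R D)).
  split; first exact: (measurableT_comp mf mU).
  have [K fK] := tf.2; exists K => psi h; apply: fK; exact: unitary_unit_ket.
rewrite /average /Rintegral; congr fine.
rewrite [RHS](@eq_measure_integral _ _ _ setT (pushforward mu (fun psi : ket R D => (U *m psi : ket R D)))).
  rewrite integral_pushforward //=.
  - exact/measurable_EFinP.
  - exact: (tame_integrable mu_pure tfU).
move=> A mA _; rewrite /pushforward; symmetry; exact: mu_haar.2.
Qed.

(** The Householder reflection along [v] when [t] is 2 over the squared norm of [v]. *)
Definition reflection (v : 'cV[C]_D) (t : R) : 'M[C]_D :=
  1%:M - t%:C *: (v *m v ^t*).

Lemma reflection_unitary v t : v ^t* *m v = (2 / t)%:C%:M -> t != 0 ->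
  reflection v t \is unitarymx.
Proof.
move=> hv t0; apply/unitarymxP.
have -> : (reflection v t) ^t* = reflection v t.
  rewrite /reflection linearB /= linearZ /= trmx1 trmx_mul map_mxB map_mx1.
  by rewrite map_mxZ map_mxM /= trmxCK conjC_real.
rewrite /reflection mulmxBr mulmx1 mulmxBl mul1mx -scalemxAl -scalemxAr.
rewrite mulmxA -(mulmxA v) hv mul_mx_scalar -scalemxAl.
have -> : t%:C *: (t%:C *: ((2 / t)%:C *: (v *m v^t*))) =
    t%:C *: (v *m v ^t*) + t%:C *: (v *m v ^t*).
  rewrite !scalerA -scalerDl; congr (_ *: _).
  by rewrite -!rmorphM -rmorphD; congr (_%:C); field.
by rewrite opprB addrK subrK.
Qed.

(* The reflection along [(1 - c) e_i - c e_j], where [c = 1 / sqrt 2], sends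
   the amplitude of [i] to the balanced superposition of those of [i] and [j]. *)
Lemma balanced_unitary (i j : 'I_D) : i != j ->
  exists2 U : 'M[C]_D, U \is unitarymx &
    forall psi : ket R D,
      (U *m psi) i 0 = ((Num.sqrt 2)^-1)%:C * (psi i 0 + psi j 0).
Proof.
move=> ij; have : (Num.sqrt 2)^-1 ^+ 2 = 2^-1 :> R by rewrite exprVn sqr_sqrtr.
move: (_^-1) => c c2.
have c1 : 1 - c != 0.
  apply/eqP => h; have c1 : c = 1 by lra.
  by move: c2; rewrite c1 expr1n => h'; lra.
pose v : 'cV[C]_D := \col_k ((1 - c)%:C * (k == i)%:R - c%:C * (k == j)%:R).
have vE (w : ket R D) : (v ^t* *m w) 0 0 = (1 - c)%:C * w i 0 - c%:C * w j 0.
  rewrite mxE (bigD1 i) //= (bigD1 j) 1?eq_sym //= big1 ?addr0.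
    rewrite !mxE eqxx (negPf ij) eq_sym (negPf ij) eqxx !mulr0 !mulr1 subr0 sub0r.
    by rewrite -rmorphN !conjC_real rmorphN mulNr.
  by move=> k /andP[/negPf ki /negPf kj]; rewrite !mxE ki kj !mulr0 subrr conjC0 mul0r.
(* Since [c ^+ 2 = 1/2], the squared norm of [v] is [(1 - c)^2 + c^2 = 2 (1 - c)], which fixes the
   parameter. *)
exists (reflection v (1 - c)^-1).
  apply: reflection_unitary; last by rewrite invr_neq0.
  rewrite [LHS]mx11_scalar vE !mxE eqxx (negPf ij) eq_sym (negPf ij) eqxx.
  rewrite !mulr0 !mulr1 subr0 sub0r mulrN opprK -!rmorphM -rmorphD.
  congr ((_)%:C%:M); rewrite invrK -!expr2 c2; have := c2; nra.
move=> psi; rewrite /reflection mulmxBl mul1mx -scalemxAl -mulmxA mxE mxE [in X in _ + X]mxE.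
rewrite mxE big_ord1 vE mxE eqxx (negPf ij) mulr0 mulr1 subr0 mulrA -rmorphM mulVf //.
rewrite rmorph1 mul1r rmorphB rmorph1; ring.
Qed.

Lemma swap_unitary (i j : 'I_D) : i != j ->
  exists2 U : 'M[C]_D, U \is unitarymx &
    forall psi : ket R D, (U *m psi) i 0 = psi j 0 /\ (U *m psi) j 0 = psi i 0.
Proof.
move=> ij; exists (perm_mx (tperm i j)).
  by apply/unitarymxP; rewrite tr_perm_mx map_perm_mx -perm_mxM mulgV perm_mx1.
by move=> psi; rewrite -row_permE !mxE tpermL tpermR.
Qed.

Lemma phase_unitary (x : 'I_D) (w : C) : w * w^*%R = 1 ->
  exists2 U : 'M[C]_D, U \is unitarymx &
    forall (psi : ket R D) k,
      (U *m psi) k 0 = (if k == x then w else 1) * psi k 0.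
Proof.
move=> w1; exists (diag_mx (\row_k if k == x then w else 1)).
  apply/unitarymxP; rewrite tr_diag_mx map_diag_mx mulmx_diag -diag_const_mx.
  congr diag_mx; apply/rowP => k; rewrite !mxE.
  by case: eqP => _; [exact: w1|rewrite rmorph1 mulr1].
by move=> psi k; rewrite mul_diag_mx !mxE.
Qed.

(** The balanced unitary turns the weight of [i] into [|psi_i + psi_j|^2 / 2 = (T + r) / 2];
    changing the sign of the amplitude of [j] then turns [r] into [- r]. *)
Lemma haar_weight_pow (i j : 'I_D) k : i != j ->
  let T psi := weight i psi + weight j psi in
  let r psi := 2 * overlap i j psi in
  average mu (fun psi => weight i psi ^+ k) =
    average mu (fun psi => ((T psi + r psi) / 2) ^+ k) /\
  average mu (fun psi => weight i psi ^+ k) =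
    average mu (fun psi => ((T psi - r psi) / 2) ^+ k).
Proof.
move=> ij T r.
have tT : tame T by apply: tameD; exact: tame_weight.
have tr : tame r by apply: tameZ; exact: tame_overlap.
have [U uU UE] := balanced_unitary ij.
have E1 : average mu (fun psi => weight i psi ^+ k) =
    average mu (fun psi => ((T psi + r psi) / 2) ^+ k).
  rewrite -(haar_average uU); last exact/tameX/tame_weight.
  congr average; apply/funext => psi; congr (_ ^+ k).
  have c2 : (Num.sqrt 2)^-1 ^+ 2 = 2^-1 :> R by rewrite exprVn sqr_sqrtr.
  rewrite /T /r /overlap !weightE UE; move: (Num.sqrt 2)^-1 c2 => c c2.
  case: (psi i 0) (psi j 0) => a b [a' b'] /=.
  have -> : (c * (a + a') - 0 * (b + b')) ^+ 2 + (c * (b + b') + 0 * (a + a')) ^+ 2 =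
    c ^+ 2 * ((a + a') ^+ 2 + (b + b') ^+ 2) by ring.
  by rewrite c2; field.
split; [exact: E1|rewrite E1].
have w1 : (-1 : C) * (-1)^*%R = 1 by rewrite rmorphN rmorph1 mulrNN mulr1.
have [P uP PE] := phase_unitary j w1.
rewrite -(haar_average uP); last first.
  by apply: tameX; apply: tameZr; exact: tameD.
congr average; apply/funext => psi; congr ((_ / _) ^+ k).
rewrite /T /r /overlap !weightE !PE (negPf ij) eqxx mul1r mulN1r rmorphN mulrN.
by case: (psi i 0) (psi j 0) => a b [a' b'] /=; ring.
Qed.

Lemma haar_weight_pow_eq (i j : 'I_D) k :
  average mu (fun psi => weight i psi ^+ k) =
  average mu (fun psi => weight j psi ^+ k).
Proof.
have [->//|ij] := eqVneq i j.
have [U uU UE] := swap_unitary ij.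
rewrite -(haar_average uU); last exact/tameX/tame_weight.
by congr average; apply/funext => psi; rewrite /weight (UE psi).1.
Qed.

Lemma haar_weight_mono_swap (i j : 'I_D) k l : i != j ->
  average mu (fun psi => weight i psi ^+ k * weight j psi ^+ l) =
  average mu (fun psi => weight i psi ^+ l * weight j psi ^+ k).
Proof.
move=> ij; have [U uU UE] := swap_unitary ij.
rewrite -(haar_average uU); last by apply: tameM; exact/tameX/tame_weight.
by congr average; apply/funext => psi; rewrite /weight !(UE psi).1 !(UE psi).2 mulrC.
Qed.

(** By symmetry all [D] weights have the same mean, and they sum to 1. *)
Lemma haar_weight1 (i : 'I_D) : average mu (weight i) = D%:R^-1.
Proof.
have E : \sum_(j < D) average mu (weight j) = 1.
  rewrite -(average_sum mu_pure); last exact: tame_weight.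
  rewrite -[RHS](average_cst mu); apply: eq_average => //.
  - by apply: tame_sum; exact: tame_weight.
  - exact: tame_cst.
  - by move=> psi /sum_weight.
have D0 : D%:R != 0 :> R by rewrite pnatr_eq0; case: (D) i => [[]|].
apply: (mulfI D0); rewrite mulfV //; apply: etrans E.
rewrite [RHS](eq_bigr (fun=> average mu (weight i))); last first.
  by move=> j _; have := haar_weight_pow_eq j i 1.
by rewrite sumr_const card_ord mulr_natl.
Qed.

(* [E w_i^k <= c_k E w_i^(k-1) w_j] with [c_2, c_3, c_4 = 3, 5, 9]: average
   [((T + r)/2)^k] over the sign of [r] and use [r^2 <= 4 w_i w_j]. *)
Lemma haar_weight_pow_step (i j : 'I_D) : i != j ->
  [/\ average mu (fun psi => weight i psi ^+ 2) <=
        3 * average mu (fun psi => weight i psi ^+ 1 * weight j psi ^+ 1),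
      average mu (fun psi => weight i psi ^+ 3) <=
        5 * average mu (fun psi => weight i psi ^+ 2 * weight j psi ^+ 1)
    & average mu (fun psi => weight i psi ^+ 4) <=
        9 * average mu (fun psi => weight i psi ^+ 3 * weight j psi ^+ 1)].
Proof.
move=> ij.
have tm (a b c d : nat) : tame (fun psi : ket R D =>
    weight i psi ^+ a * weight j psi ^+ b + weight i psi ^+ c * weight j psi ^+ d).
  by apply: tameD; apply: tameM; exact/tameX/tame_weight.
(* Both signs of [r] give the same mean, so twice the moment is the mean of the symmetrized power.
   [H] bounds the latter pointwise with [x, y, o] for the two weights and the overlap; the swap of
   [i] and [j] merges the mixed terms. *)
have key (k a b : nat) (q : R) :
    (forall x y o : R, 0 <= x -> 0 <= y -> o ^+ 2 <= x * y ->
       ((x + y + 2 * o) / 2) ^+ k + ((x + y - 2 * o) / 2) ^+ k <=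
       (2 / 2 ^+ k) * (x ^+ k + y ^+ k + q * (x ^+ a * y ^+ b + x ^+ b * y ^+ a))) ->
    2 * average mu (fun psi => weight i psi ^+ k) <=
    (2 / 2 ^+ k) * (2 * average mu (fun psi => weight i psi ^+ k) +
      2 * q * average mu (fun psi => weight i psi ^+ a * weight j psi ^+ b)).
  move=> H; have [E1 E2] := haar_weight_pow k ij.
  have tT : tame (fun psi : ket R D => weight i psi + weight j psi).
    by apply: tameD; exact: tame_weight.
  have tr : tame (fun psi : ket R D => 2 * overlap i j psi) by apply: tameZ; exact: tame_overlap.
  have tp : tame (fun psi : ket R D => ((weight i psi + weight j psi + 2 * overlap i j psi) / 2) ^+ k).
    by apply: tameX; apply: tameZr; exact: tameD.
  have tn : tame (fun psi : ket R D => ((weight i psi + weight j psi - 2 * overlap i j psi) / 2) ^+ k).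
    apply: tameX; apply: tameZr; apply: tameD => //.
    by under eq_fun do rewrite -mulN1r; exact: tameZ.
  have tk : tame (fun psi : ket R D => weight i psi ^+ k + weight j psi ^+ k).
    by apply: tameD; exact/tameX/tame_weight.
  rewrite [in leLHS]mulr_natl mulr2n {1}E1 E2 -averageD //.
  apply: (@le_trans _ _ (average mu (fun psi => (2 / 2 ^+ k) *
    (weight i psi ^+ k + weight j psi ^+ k +
     q * (weight i psi ^+ a * weight j psi ^+ b + weight i psi ^+ b * weight j psi ^+ a))))).
    apply: le_average => //.
    - exact: tameD.
    - by apply: tameZ; apply: tameD => //; exact: tameZ.
    - by move=> psi _; apply: H; rewrite ?weight_ge0 ?overlap_sqr_le.
  rewrite averageZ //; last by apply: tameD => //; exact: tameZ.
  rewrite averageD //; last exact: tameZ.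
  rewrite averageZ // averageD; try exact/tameX/tame_weight; last by [].
  rewrite averageD //; try (by apply: tameM; exact/tameX/tame_weight).
  rewrite (haar_weight_pow_eq j i) (haar_weight_mono_swap b a ij) -E2.
  set m := average mu _; set m' := average mu _.
  by have -> : m + m + q * (m' + m') = 2 * m + 2 * q * m' by ring.
split.
(* The values 3, 15, 63 of [q] come from expanding the symmetrized power and replacing [o ^+ 2] by
   [x * y]; for [k = 4] the term [70 x^2 y^2] is absorbed by [2 x^2 y^2 <= x^3 y + x y^3]. Solving
   for the moment divides [q] by [2^(k-1) - 1], leaving 3, 5, 9. *)
- lapply (key 2 1%N 1%N 3) => [|x y o x0 y0 h].
    have -> : (2 / 2 ^+ 2 : R) = 2^-1 by field.
    lra.
  have -> : (2 / 2 ^+ 2 : R) = 2^-1 by field.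
  lra.
- lapply (key 3 2 1%N 15) => [|x y o x0 y0 h].
    have -> : (2 / 2 ^+ 3 : R) = 4^-1 by field.
    lra.
  have -> : (2 / 2 ^+ 3 : R) = 4^-1 by field.
  have : 0 <= (x + y) * (x * y - o ^+ 2).
    by apply: mulr_ge0; [exact: addr_ge0|rewrite subr_ge0].
  lra.
- lapply (key 4 3 1%N 63) => [|x y o x0 y0 h].
    have -> : (2 / 2 ^+ 4 : R) = 8^-1 by field.
    lra.
  have -> : (2 / 2 ^+ 4 : R) = 8^-1 by field.
  have h1 : 0 <= (x + y) ^+ 2 * (x * y - o ^+ 2) by apply: mulr_ge0; [exact: sqr_ge0|rewrite subr_ge0].
  have h2 : 0 <= (x * y - o ^+ 2) * (x * y + o ^+ 2).
    apply: mulr_ge0; first by rewrite subr_ge0.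
    by apply: addr_ge0; [exact: mulr_ge0|exact: sqr_ge0].
  have h3 : 0 <= x * y * (x - y) ^+ 2 by apply: mulr_ge0; [exact: mulr_ge0|exact: sqr_ge0].
  lra.
Qed.

(** Summing the previous bounds over the [D - 1] indices [j != i], whose weights add up to at most
    1, lowers the power by one at the cost of [c_k / (D - 1)]. Three such steps from the mean
    [1 / D] give [135 = 3 * 5 * 9]. *)
Lemma haar_weight_pow4 (i : 'I_D) : (2 <= D)%N ->
  average mu (fun psi => weight i psi ^+ 4) <= 135 / ((D%:R - 1) ^+ 3 * D%:R).
Proof.
move=> D2.
have step (k : nat) (c : R) : 0 <= c ->
    (forall j, i != j -> average mu (fun psi => weight i psi ^+ k.+1) <=
      c * average mu (fun psi => weight i psi ^+ k * weight j psi ^+ 1)) ->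
    (D%:R - 1) * average mu (fun psi => weight i psi ^+ k.+1) <=
      c * average mu (fun psi => weight i psi ^+ k).
  move=> c0 H; pose F (j : 'I_D) (psi : ket R D) :=
    if i == j then 0 else weight i psi ^+ k * weight j psi ^+ 1.
  have tF j : tame (F j).
    rewrite /F; case: eqP => _; first exact: tame_cst.
    by apply: tameM; exact/tameX/tame_weight.
  have H1 : \sum_(j < D) average mu (F j) <= average mu (fun psi => weight i psi ^+ k).
    rewrite -(average_sum mu_pure) //; apply: le_average => //.
    - exact: tame_sum.
    - exact/tameX/tame_weight.
    - move=> psi h; rewrite -[leRHS]mulr1 -(sum_weight h) mulr_sumr.
      apply: ler_sum => j _; rewrite /F; case: eqP => // _.
      by rewrite mulr_ge0 ?exprn_ge0 ?weight_ge0.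
  apply: le_trans (ler_wpM2l c0 H1); rewrite mulr_sumr (bigD1 i) //=.
  rewrite {1}/F eqxx average_cst mulr0 add0r.
  apply: (@le_trans _ _ (\sum_(j < D | j != i) average mu (fun psi => weight i psi ^+ k.+1))).
    rewrite sumr_const -[leRHS]mulr_natl ler_wpM2r //.
      by apply: Rintegral_ge0 => psi _; rewrite exprn_ge0 ?weight_ge0.
    rewrite (eq_card (_ : _ =i predC1 i)) // cardC1 card_ord -subn1 natrB //.
    exact: leq_trans D2.
  apply: ler_sum => j ji; apply: le_trans (H j _) _; first by rewrite eq_sym.
  by rewrite /F eq_sym (negPf ji).
have H2 : (D%:R - 1) * average mu (fun psi => weight i psi ^+ 2) <=
    3 * average mu (fun psi => weight i psi ^+ 1).
  by apply: step => // j /haar_weight_pow_step[].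
have H3 : (D%:R - 1) * average mu (fun psi => weight i psi ^+ 3) <=
    5 * average mu (fun psi => weight i psi ^+ 2).
  by apply: step => // j /haar_weight_pow_step[].
have H4 : (D%:R - 1) * average mu (fun psi => weight i psi ^+ 4) <=
    9 * average mu (fun psi => weight i psi ^+ 3).
  by apply: step => // j /haar_weight_pow_step[].
have D1 : 0 < D%:R - 1 :> R by rewrite subr_gt0 ltr1n.
have D0 : 0 < D%:R :> R by rewrite ltr0n; exact: leq_trans D2.
rewrite ler_pdivlMr ?mulr_gt0 ?exprn_gt0 //.
move: H2; have -> : average mu (fun psi => weight i psi ^+ 1) = D%:R^-1.
  exact: haar_weight1.
move: H3 H4; set m3 := average _ _; set m2 := average _ _; set m4 := average _ _.
move: D1; set E := D%:R - 1 => E0 H3 H4 H2.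
have H2' : E * m2 * D%:R <= 3 by rewrite -ler_pdivlMr.
have -> : m4 * (E ^+ 3 * D%:R) = E ^+ 2 * D%:R * (E * m4) by ring.
apply: (@le_trans _ _ (E ^+ 2 * D%:R * (9 * m3))).
  by rewrite ler_wpM2l // mulr_ge0 ?sqr_ge0 // ltW.
have -> : E ^+ 2 * D%:R * (9 * m3) = 9 * (E * D%:R * (E * m3)) by ring.
apply: (@le_trans _ _ (9 * (E * D%:R * (5 * m2)))).
  by rewrite !ler_wpM2l // mulr_ge0 // ltW.
lra.
Qed.

End Haar.

(** * Haar averages of monomials of degree four *)

Definition matched (T : eqType) (i j : 'I_4 -> T) :=
  [exists s : 'S_4, [forall t, i t == j (s t)]].

(** Two families are matched exactly when they agree as multisets, so otherwise some value has
    different multiplicities. *)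
Lemma unmatched_count (T : finType) (i j : 'I_4 -> T) : ~~ matched i j ->
  exists x, #|[pred t | i t == x]| != #|[pred t | j t == x]|.
Proof.
have cnt (f : 'I_4 -> T) x :
    count_mem x [tuple f t | t < 4] = #|[pred t | f t == x]|.
  by rewrite count_map val_ord_tuple -size_filter cardE [in RHS]/enum_mem -enumT.
case: (boolP (perm_eq [tuple i t | t < 4] [tuple j t | t < 4])).
  move=> /tuple_permP[s Es] /negP[]; apply/existsP; exists s; apply/forallP => t.
  have /(congr1 (fun u => tnth u t)) : [tuple i t | t < 4] =
    [tuple tnth [tuple j t | t < 4] (s t) | t < 4] by exact: val_inj.
  by rewrite !tnth_mktuple => ->.
by move=> /allPn[x _ h] _; exists x; rewrite -!cnt; exact: h.
Qed.

Section HaarMonomials.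
Variables (R : realType) (D : nat).
Local Notation C := R[i].

(* A rational point of the unit circle which is not a root of unity of order
   at most 4. *)
Definition rational_phase : C := (3 / 5 +i* (4 / 5))%C.

Lemma rational_phase_norm : rational_phase * rational_phase^*%R = 1.
Proof. by apply/eqP; rewrite eq_complex /=; apply/andP; split; apply/eqP; field. Qed.

Lemma rational_phase_pow k : (0 < k <= 4)%N -> rational_phase ^+ k != 1.
Proof.
case: k => [|[|[|[|[|//]]]]] // _; rewrite /rational_phase ?expr1 ?exprS ?expr0;
  rewrite eq_complex /= negb_and; apply/orP; left; apply/eqP; lra.
Qed.

Lemma rational_phase_neq1 p q : (p <= 4)%N -> (q <= 4)%N -> p != q ->
  rational_phase ^+ p * (rational_phase^*%R) ^+ q != 1.
Proof.
move=> p4 q4; rewrite neq_ltn => /orP[pq|qp].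
  rewrite -(subnKC (ltnW pq)) exprD mulrA -exprMn rational_phase_norm expr1n mul1r.
  have : rational_phase ^+ (q - p) != 1.
    by rewrite rational_phase_pow // subn_gt0 pq (leq_trans (leq_subr _ _)).
  apply: contraNneq => /(congr1 (fun z => z^*%R)).
  by rewrite rmorphXn /= conjCK rmorph1 => ->.
rewrite -(subnKC (ltnW qp)) exprD mulrAC -exprMn rational_phase_norm expr1n mul1r.
by rewrite rational_phase_pow // subn_gt0 qp (leq_trans (leq_subr _ _)).
Qed.

Variable mu : probability (ket R D) R.
Hypothesis mu_haar : haar mu.
Let mu_pure : pure_ensemble mu := mu_haar.1.

(** A phase on a coordinate [x] that occurs with different multiplicities in [i] and [j] multiplies
    the monomial by some [z != 1]. By invariance the mean equals [z] times itself and vanishes. *)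
Lemma haar_unmatched (i j : 'I_4 -> 'I_D) : ~~ matched i j ->
  average mu (fun psi => complex.Re (moment_monomial i j psi)) = 0.
Proof.
move=> /unmatched_count[x xij].
have [U uU UE] := phase_unitary x rational_phase_norm.
set p := #|_| in xij; set q := #|_| in xij.
have le4 (A : pred 'I_4) : (#|A| <= 4)%N by rewrite -[leqRHS]card_ord max_card.
have z1 := rational_phase_neq1 (le4 _ : p <= 4)%N (le4 _ : q <= 4)%N xij.
move: z1; set z := _ * _ => z1.
have ME (psi : ket R D) : moment_monomial i j (U *m psi) = z * moment_monomial i j psi.
  rewrite /moment_monomial.
  under eq_bigr do rewrite !UE rmorphM mulrACA.
  rewrite big_split big_split /=; congr (_ * _ * _).
    by rewrite -big_mkcond /= prodr_const.
  rewrite (eq_bigr (fun t => if j t == x then rational_phase^*%R else 1)).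
    by rewrite -big_mkcond /= prodr_const.
  by move=> t _; case: eqP => _ //; rewrite rmorph1.
have [tr ti] := tame_monomial R i j.
set e1 := average mu _.
(* Averages are real, so real and imaginary parts are rotated separately and then reassembled into
   one complex equation. *)
pose e2 := average mu (fun psi => complex.Im (moment_monomial i j psi)).
have E1 : e1 = complex.Re z * e1 + (- complex.Im z) * e2.
  rewrite {1}/e1 -(haar_average mu_haar uU) // -!averageZ // -averageD //; try exact: tameZ.
  congr average; apply/funext => psi; rewrite ME.
  by case: (z) (moment_monomial _ _ _) => a b [a' b'] /=; ring.
have E2 : e2 = complex.Re z * e2 + complex.Im z * e1.
  rewrite {1}/e2 -(haar_average mu_haar uU) // -!averageZ // -averageD //; try exact: tameZ.
  congr average; apply/funext => psi; rewrite ME.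
  by case: (z) (moment_monomial _ _ _) => a b [a' b'] /=; ring.
have : (e1 +i* e2)%C = z * (e1 +i* e2)%C.
  apply/eqP; rewrite eq_complex; apply/andP; split; apply/eqP.
    by rewrite {1}[LHS]/= {1}E1; case: (z) => a b /=; ring.
  by rewrite {1}[LHS]/= {1}E2; case: (z) => a b /=; ring.
move/eqP; rewrite -subr_eq0 -{1}[X in X - _]mul1r -mulrBl mulf_eq0 subr_eq0.
by rewrite eq_sym (negPf z1) /= => /eqP[].
Qed.

Lemma haar_monomial_le (i j : 'I_4 -> 'I_D) : (2 <= D)%N ->
  average mu (fun psi => complex.Re (moment_monomial i j psi)) <=
  (matched i j)%:R * (135 / ((D%:R - 1) ^+ 3 * D%:R)).
Proof.
move=> D2; case: (boolP (matched i j)) => [_|/haar_unmatched ->]; last by rewrite mul0r.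
rewrite mul1r; set M := _ / _.
have t4 k : tame (fun psi : ket R D => weight k psi ^+ 4) by exact/tameX/tame_weight.
have ts t : tame (fun psi : ket R D => weight (i t) psi ^+ 4 + weight (j t) psi ^+ 4).
  exact: tameD.
apply: (@le_trans _ _ (average mu (fun psi => 8^-1 *
    \sum_t (weight (i t) psi ^+ 4 + weight (j t) psi ^+ 4)))).
  apply: le_average => //; first exact: (tame_monomial R i j).1.
    by apply: tameZ; exact: tame_sum.
  by move=> psi _; exact: monomial_le_weights.
rewrite averageZ //; last exact: tame_sum.
rewrite average_sum // ler_pdivrMl //.
apply: (@le_trans _ _ (\sum_(t < 4) (M + M))).
  by apply: ler_sum => t _; rewrite averageD // lerD // haar_weight_pow4.
by rewrite sumr_const card_ord; lra.
Qed.

End HaarMonomials.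

(** * Monomial averages of state 4-designs *)

Section Designs.
Variables (R : realType) (D : nat).
Local Notation C := R[i].

Lemma ntensmx4_entry (i j : 'I_4 -> 'I_D) :
  exists k l, forall M : 'M[C]_D, ntensmx M 4 k l = \prod_t M (i t) (j t).
Proof.
pose e (f : 'I_4 -> 'I_D) : 'I_(D ^ 4) := mxtens_index (f (inord 0),
  mxtens_index (f (inord 1), mxtens_index (f (inord 2), f (inord 3)))).
exists (e i), (e j) => M; rewrite !ntensmxS !tensmxE.
rewrite !big_ord_recl big_ord0 mulr1; do ! congr (_ * _); congr (M (i _) (j _));
  by apply: val_inj; rewrite /= inordK.
Qed.

Lemma design_average_monomial (nu mu : probability (ket R D) R) i j :
  state_design 4 nu -> haar mu ->
  average nu (fun psi => complex.Re (moment_monomial i j psi)) =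
  average mu (fun psi => complex.Re (moment_monomial i j psi)).
Proof.
move=> [_ h] /h /matrixP E; have [k [l kl]] := ntensmx4_entry i j.
have ME (psi : ket R D) : moment_monomial i j psi = ntensmx (proj_ket psi) 4 k l.
  by rewrite kl; apply: eq_bigr => t _; rewrite mxE big_ord1 !mxE.
under eq_fun do rewrite ME.
by have := E k l; rewrite !mxE => -[].
Qed.

End Designs.

(** * Counting index patterns *)

(* An invariant coloring is determined by its values at the points that are
   minimal in their orbit. *)
Definition orbit_minimal (g : nat -> nat) t :=
  [&& t <= g t, t <= g (g t) & t <= g (g (g t))]%N.

(** For a permutation of four points, a point and its first three iterates exhaust its orbit, so
    this is the number of cycles. *)
Definition orbit_count (g : nat -> nat) := count (orbit_minimal g) (iota 0 4).

(** Restriction to the minimal points is injective on invariant colorings, by strong induction: at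
    any other point one of the three iterates is smaller and carries the same color. *)
Lemma card_invariant_ffun (T : finType) (f : 'I_4 -> 'I_4) (g : nat -> nat) :
  (forall t, g (val t) = val (f t)) ->
  (#|[pred a : {ffun 'I_4 -> T} | [forall t, a t == a (f t)]]| <=
     #|T| ^ orbit_count g)%N.
Proof.
move=> gf; pose P := [pred t : 'I_4 | orbit_minimal g (val t)].
have -> : orbit_count g = #|{: {t | P t}}|.
  rewrite card_sig cardE /enum_mem -enumT size_filter.
  by rewrite /orbit_count -val_enum_ord count_map; apply: eq_count.
rewrite -card_ffun.
pose h (a : {ffun 'I_4 -> T}) : {ffun {t | P t} -> T} := [ffun u => a (val u)].
apply: (@leq_card_in _ _ h) => a a'; rewrite !inE => /forallP ha /forallP ha' Eh.
apply/ffunP => t; have [m] := ubnP (val t); elim: m t => // m IH t tm.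
have step (u : 'I_4) : a (f u) = a' (f u) -> a u = a' u.
  by move=> E; rewrite (eqP (ha u)) E -(eqP (ha' u)).
have [Pt|] := boolP (P t).
  by have /ffunP/(_ (exist _ t Pt)) := Eh; rewrite !ffunE.
rewrite /P /= /orbit_minimal !gf !negb_and -!ltnNge => /or3P[] lt_t.
- by apply/step/IH/(leq_trans lt_t).
- by apply/step/step/IH/(leq_trans lt_t).
- by apply/step/step/step/IH/(leq_trans lt_t).
Qed.

(** The list [l] holds the values of a permutation [s]; the entries count the cycles of
    [t |-> s t + 1], of [t |-> s (t - 1)] and of [s], modulo 4. Adding 4 before the predecessor
    sends 0 to 3. Lists of numbers let the enumeration compute. *)
Definition cycle_exponents (l : seq nat) : nat * nat * nat :=
  (orbit_count (fun t => (nth 0 l t).+1 %% 4),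
   orbit_count (fun t => nth 0 l ((t + 4).-1 %% 4)),
   orbit_count (nth 0 l))%N.

Definition cycle_bounds (abc : nat * nat * nat) :=
  let: (a, b, c) := abc in
  [&& a <= 4, b <= 4, c <= 4, a + c <= 5, b + c <= 5 & a + b <= 6]%N.

(* The genus inequalities for a permutation of four points against the 4-cycle
   and its inverse, by enumeration. *)
Lemma cycle_bounds_perm l : perm_eq l (iota 0 4) -> cycle_bounds (cycle_exponents l).
Proof.
rewrite -mem_permutations; apply/allP: l.
by vm_compute.
Qed.

(** * The mean of the fourth moment as a sum over permutations *)

Section FourthMomentBound.
Variables (R : realType) (dA dB dC : nat).
Local Notation C := R[i].
Let D := (dA * dB * dC)%N.
Let idx (a : {ffun 'I_4 -> 'I_dA}) (b : {ffun 'I_4 -> 'I_dB})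
    (c : {ffun 'I_4 -> 'I_dC}) t : 'I_D := ABC_index (a t) (b (ordS t)) (c t).
Let jdx (a : {ffun 'I_4 -> 'I_dA}) (b : {ffun 'I_4 -> 'I_dB})
    (c : {ffun 'I_4 -> 'I_dC}) t : 'I_D := ABC_index (a (ordS t)) (b t) (c t).

Variable T : nat.
Hypothesis hT : forall a b c, cycle_bounds (a, b, c) ->
  (dA ^ a * dB ^ b * dC ^ c <= T)%N.

(** Matching by [s] splits into separate invariance conditions on [a], [b] and [c], so the count is
    at most a product of three powers whose exponents obey the genus inequalities. *)
Lemma card_matched_by (s : 'S_4) :
  (\sum_a \sum_b \sum_c [forall t, idx a b c t == jdx a b c (s t)] <= T)%N.
Proof.
pose l := [seq val (s t) | t <- enum 'I_4].
have lE (t : 'I_4) : nth 0%N l (val t) = val (s t).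
  by rewrite (nth_map t) ?size_enum_ord ?(ltn_ord t) //; congr (val (s _)); exact: nth_ord_enum.
have pl : perm_eq l (iota 0 4).
  apply: uniq_perm; rewrite ?iota_uniq //.
    by rewrite map_inj_uniq ?enum_uniq // => x y /val_inj/perm_inj.
  move=> x; rewrite mem_iota /= add0n; apply/idP/idP => [/mapP[t _ ->]|x4].
    exact: ltn_ord.
  by apply/mapP; exists (s^-1 (Ordinal x4))%g; rewrite ?mem_enum // permKV.
have := cycle_bounds_perm pl; rewrite /cycle_exponents => /hT; apply: leq_trans.
pose PA := [pred a : {ffun 'I_4 -> 'I_dA} | [forall t, a t == a (ordS (s t))]].
pose PB := [pred b : {ffun 'I_4 -> 'I_dB} | [forall t, b t == b (s (ord_pred t))]].
pose PC := [pred c : {ffun 'I_4 -> 'I_dC} | [forall t, c t == c (s t)]].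
apply: (@leq_trans (#|PA| * #|PB| * #|PC|)).
  rewrite -mulnA -[#|PA|]sum1_card big_distrl [leqRHS]big_mkcond /=.
  apply: leq_sum => a _; rewrite -[#|PB|]sum1_card mul1n.
  rewrite big_distrl [\sum_(b in PB) _]big_mkcond /=.
  case: ifPn => [_|nPA].
    apply: leq_sum => b _; rewrite mul1n -sum1_card.
    case: ifPn => [_|nPB].
      rewrite [leqRHS]big_mkcond /=; apply: leq_sum => c _.
      case: ifPn => [_|nPC]; first exact: leq_b1.
      rewrite leqn0 eqb0; apply: contra nPC => /forallP h; apply/forallP => t.
      by have /eqP/ABC_index_inj[_ _ ->] := h t.
    rewrite big1 // => c _; apply/eqP; rewrite eqb0; apply: contra nPB => /forallP h.
    (* The match reads [b (ordS t) = b (s t)]; taken at the predecessor of [t] it is invariance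
       under [s] after [ord_pred]. *)
    apply/forallP => t; have /eqP/ABC_index_inj[_ + _] := h (ord_pred t).
    by rewrite ord_predK => ->.
  rewrite big1 // => b _; rewrite big1 // => c _; apply/eqP; rewrite eqb0.
  apply: contra nPA => /forallP h; apply/forallP => t.
  by have /eqP/ABC_index_inj[-> _ _] := h t.
apply: leq_mul; first apply: leq_mul.
- rewrite -[X in (_ <= X ^ _)%N](card_ord dA).
  by apply: (@card_invariant_ffun _ (fun t => ordS (s t))) => t; rewrite lE.
- rewrite -[X in (_ <= X ^ _)%N](card_ord dB).
  apply: (@card_invariant_ffun _ (fun t => s (ord_pred t))) => t.
  by rewrite -lE.
- rewrite -[X in (_ <= X ^ _)%N](card_ord dC).
  by apply: (@card_invariant_ffun _ s) => t; rewrite lE.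
Qed.

Lemma tame_pt_moment4 : tame (fun psi : ket R D => pt_moment 4 (reduced_AB psi)).
Proof.
under eq_fun do rewrite pt_moment4E.
do 3! apply: tame_sum => ?; exact: (tame_monomial R _ _).1.
Qed.

(** A union bound over the 24 permutations that can match the indices, followed by an exchange of
    the sums. *)
Lemma average_pt_moment4_le (nu : probability (ket R D) R) (M : R) :
  pure_ensemble nu -> 0 <= M ->
  (forall i j : 'I_4 -> 'I_D,
    average nu (fun psi => complex.Re (moment_monomial i j psi)) <=
    (matched i j)%:R * M) ->
  average nu (fun psi => pt_moment 4 (reduced_AB psi)) <= 24 * M * T%:R.
Proof.
move=> pnu M0 hM.
have tm a b c := (tame_monomial R (idx a b c) (jdx a b c)).1.
under eq_fun do rewrite pt_moment4E.
apply: (@le_trans _ _ (\sum_a \sum_b \sum_c average nu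
    (fun psi => complex.Re (moment_monomial (idx a b c) (jdx a b c) psi)))).
  rewrite (average_sum pnu) => [|a]; last by do 2! apply: tame_sum => ?; exact: tm.
  apply: ler_sum => a _.
  rewrite (average_sum pnu) => [|b]; last by apply: tame_sum => ?; exact: tm.
  apply: ler_sum => b _.
  by rewrite (average_sum pnu) => [|c]; last exact: tm.
apply: (@le_trans _ _ (\sum_a \sum_b \sum_c \sum_(s : 'S_4)
    ([forall t, idx a b c t == jdx a b c (s t)] : nat)%:R * M)).
  do 3! apply: ler_sum => ? _.
  apply: le_trans (hM _ _) _; rewrite -mulr_suml ler_wpM2r // -natr_sum ler_nat.
  rewrite /matched; case: existsP => // -[s hs]; rewrite (bigD1 s) //=.
  by rewrite (_ : [forall t, _] = true).
apply: (@le_trans _ _ (\sum_(s : 'S_4) T%:R * M)); last first.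
  rewrite sumr_const card_Sn (_ : 4`! = 24)%N //.
  by have -> : (T%:R * M) *+ 24 = 24 * M * T%:R by ring.
under eq_bigr => a _ do under eq_bigr => b _ do rewrite exchange_big /=.
under eq_bigr => a _ do rewrite exchange_big /=.
rewrite exchange_big /=; apply: ler_sum => s _.
rewrite (eq_bigr (fun a => (\sum_b \sum_c
   ([forall t, idx a b c t == jdx a b c (s t)] : nat))%:R * M)); last first.
  move=> a _; rewrite natr_sum mulr_suml; apply: eq_bigr => b _.
  by rewrite natr_sum mulr_suml.
by rewrite -mulr_suml ler_wpM2r // -natr_sum ler_nat card_matched_by.
Qed.

End FourthMomentBound.

(** * The three phases *)

(** With [z = x + y + w] the left side is [(a + c) x + (b + c) y + c w], at most
    [5 x + 5 y + 4 w]. *)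
Lemma cycle_bounds_phase1 a b c x y z : cycle_bounds (a, b, c) ->
  (x + y <= z -> a * x + b * y + c * z <= x + y + 4 * z)%N.
Proof.
move=> /and5P[a4 b4 c4 ac /andP[bc ab]] h.
have [w ->] : exists w, z = (x + y + w)%N by exists (z - (x + y))%N; lia.
nia.
Qed.

(** Under the triangle inequalities the three genus inequalities may be weighted by [x + z - y],
    [y + z - x] and [x + y - z]; their sum is twice the claim. *)
Lemma cycle_bounds_phase2 a b c x y z : cycle_bounds (a, b, c) ->
  (z <= x + y -> x <= y + z -> y <= x + z ->
   a * x + b * y + c * z <= 3 * x + 3 * y + 2 * z)%N.
Proof.
move=> /and5P[a4 b4 c4 ac /andP[bc ab]] h1 h2 h3.
have p1 : ((a + c) * (x + z - y) <= 5 * (x + z - y))%N by rewrite leq_mul2r ac orbT.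
have p2 : ((b + c) * (y + z - x) <= 5 * (y + z - x))%N by rewrite leq_mul2r bc orbT.
have p3 : ((a + b) * (x + y - z) <= 6 * (x + y - z))%N by rewrite leq_mul2r ab orbT.
nia.
Qed.

(** With [x = y + z + w] the left side is [(a + b) y + (a + c) z + a w], at most
    [6 y + 5 z + 4 w]. *)
Lemma cycle_bounds_phase3 a b c x y z : cycle_bounds (a, b, c) ->
  (y + z <= x -> a * x + b * y + c * z <= 4 * x + 2 * y + z)%N.
Proof.
move=> /and5P[a4 b4 c4 ac /andP[bc ab]] h.
have [w ->] : exists w, x = (y + z + w)%N by exists (x - (y + z))%N; lia.
nia.
Qed.

Lemma cycle_bounds_swap a b c : cycle_bounds (a, b, c) -> cycle_bounds (b, a, c).
Proof. by rewrite /cycle_bounds; lia. Qed.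

Section Phases.
Variable R : realType.

Lemma ln_pow2 e : ln ((2 ^ e)%N%:R : R) = e%:R * ln 2.
Proof. by rewrite natrX lnXn // mulr_natl. Qed.

Lemma haar_moment_bound_le (D : nat) : (2 <= D)%N ->
  135 / ((D%:R - 1) ^+ 3 * D%:R) <= 135 * 2 ^+ 3 / D%:R ^+ 4 :> R.
Proof.
move=> D2; have D0 : 0 < D%:R :> R by rewrite ltr0n; exact: leq_trans D2.
have D2' : 2 <= D%:R :> R by rewrite ler_nat.
rewrite ler_pdivrMr ?mulr_gt0 ?exprn_gt0 ?subr_gt0 ?ltr1n //.
rewrite mulrAC ler_pdivlMr ?exprn_gt0 //.
have h : (2^-1 * D%:R) ^+ 3 <= (D%:R - 1) ^+ 3 :> R.
  by rewrite lerXn2r ?nnegrE //; lra.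
have := ler_wpM2r (ltW D0) h; rewrite exprMn exprVn; lra.
Qed.

(* 24 index permutations, each contributing at most [135 * 2 ^+ 3 / D ^+ 4]. *)
Definition gap : R := ln (24 * (135 * 2 ^+ 3)).

Lemma gap_ge0 : 0 <= gap.
Proof. by rewrite ln_ge0 //; lra. Qed.

Lemma negativity_averages_near (nA nB nC em er T : nat) (v : R)
    (nu : probability (ket R (2 ^ nA * 2 ^ nB * 2 ^ nC)) R) :
  let D := (2 ^ nA * 2 ^ nB * 2 ^ nC)%N in
  let n := (nA + nB + nC)%N in
  (0 < n)%N -> pure_ensemble nu ->
  (forall i j : 'I_4 -> 'I_D,
    average nu (fun psi => complex.Re (moment_monomial i j psi)) <=
    (matched i j)%:R * (135 / ((D%:R - 1) ^+ 3 * D%:R))) ->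
  (forall a b c, cycle_bounds (a, b, c) -> (a * nA + b * nB + c * nC <= T)%N) ->
  em = (nA + nB)%N \/ em = nC ->
  [\/ er = (nA + nB)%N, er = (nB + nB + nC)%N | er = (nA + nA + nC)%N] ->
  v = - (3 / 2) * em%:R - 2^-1 * (T%:R - 4 * n%:R) ->
  v = 3 / 4 * er%:R + 4^-1 * (T%:R - 4 * n%:R) ->
  `|average nu (fun psi => log_negativity (reduced_AB psi)) - v * ln 2|
    <= gap /\
  `|average nu (fun psi => log_negativity4 (reduced_AB psi)) - v * ln 2|
    <= gap.
Proof.
move=> D n n0 pnu hM hT hem her vm vr.
have DE : D = (2 ^ n)%N by rewrite /D -!expnD.
have D2 : (2 <= D)%N by rewrite DE -[X in (X <= _)%N]expn1 leq_exp2l.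
have D0 : 0 < D%:R :> R by rewrite ltr0n; exact: leq_trans D2.
set M := _ / _ in hM.
have M0 : 0 <= M.
  by rewrite divr_ge0 // mulr_ge0 ?exprn_ge0 // subr_ge0 ler1n; exact: leq_trans D2.
pose q : R := 24 * (135 * 2 ^+ 3) * (2 ^ T)%N%:R / D%:R ^+ 4.
have q0 : 0 < q by rewrite divr_gt0 ?exprn_gt0 // mulr_gt0 // ltr0n expn_gt0.
have lnq : ln q = gap + (T%:R - 4 * n%:R) * ln 2.
  have D40 : 0 < D%:R ^+ 4 :> R by exact: exprn_gt0.
  have T0 : 0 < (2 ^ T)%N%:R :> R by rewrite ltr0n expn_gt0.
  have K0 : 0 < 24 * (135 * 2 ^+ 3) :> R by rewrite !mulr_gt0.
  rewrite /q ln_div ?posrE ?mulr_gt0 // lnM ?posrE // -/gap ln_pow2 lnXn //.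
  rewrite DE ln_pow2 -[_ *+ 4]mulr_natl.
  by ring.
pose p4 psi := pt_moment 4 (@reduced_AB R (2 ^ nA) (2 ^ nB) (2 ^ nC) psi).
have tp4 : tame p4 by exact: tame_pt_moment4.
have p4q : average nu p4 <= q.
  apply: le_trans (average_pt_moment4_le (T := (2 ^ T)%N) _ pnu M0 hM) _.
    by move=> a b c /hT h; rewrite -!expnM -!expnD leq_exp2l // (mulnC nA) (mulnC nB) (mulnC nC).
  have -> : q = 24 * (135 * 2 ^+ 3 / D%:R ^+ 4) * (2 ^ T)%N%:R by rewrite /q; ring.
  by rewrite ler_wpM2r ?ler0n // ler_wpM2l // haar_moment_bound_le.
clearbody q.
have hp2 psi : unit_ket psi ->
    1 <= (2 ^ em)%N%:R * pt_moment 2 (@reduced_AB R (2 ^ nA) (2 ^ nB) (2 ^ nC) psi).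
  by move=> /purity_ge[h1 h2]; case: hem => ->; rewrite ?expnD.
have hrk psi : (\rank (ptranspose (@reduced_AB R (2 ^ nA) (2 ^ nB) (2 ^ nC) psi)) <= 2 ^ er)%N.
  by have [h1 h2 h3] := rank_ptranspose_reduced psi; case: her => ->; rewrite !expnD.
pose l psi : R := - (3 / 2) * ln (2 ^ em)%N%:R - 2^-1 * (ln q - 1) + - (2 * q)^-1 * p4 psi.
pose u psi : R := 3 / 4 * ln (2 ^ er)%N%:R + 4^-1 * (ln q - 1) + (4 * q)^-1 * p4 psi.
have tl : tame l by apply: tameD; [exact: tame_cst|exact: tameZ].
have tu : tame u by apply: tameD; [exact: tame_cst|exact: tameZ].
have sq (psi : ket R D) (h : unit_ket psi) :=
  negativity_squeeze q0 h (hp2 psi h) (hrk psi).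
have al : average nu l >= v * ln 2 - gap.
  rewrite /l averageD ?average_cst ?averageZ //; try exact: tame_cst; try exact: tameZ.
  have : (2 * q)^-1 * average nu p4 <= 2^-1 by rewrite ler_pdivrMl ?mulr_gt0 //; lra.
  have := gap_ge0; rewrite lnq ln_pow2 vm; lra.
have au : average nu u <= v * ln 2 + gap.
  rewrite /u averageD ?average_cst ?averageZ //; try exact: tame_cst; try exact: tameZ.
  have : (4 * q)^-1 * average nu p4 <= 4^-1 by rewrite ler_pdivrMl ?mulr_gt0 //; lra.
  have := gap_ge0; rewrite lnq ln_pow2 vr; lra.
have near f : (forall psi, unit_ket psi -> l psi <= f psi <= u psi) ->
    `|average nu f - v * ln 2| <= gap.
  move=> /(average_sandwich pnu tl tu)/andP[h1 h2].
  by rewrite ler_norml; apply/andP; split; lra.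
split; apply: near => psi /sq[h1 h2 h3]; apply/andP; split.
- by rewrite /l [X in _ + X]mulNr; exact: le_trans h2.
- exact: h3.
- by rewrite /l [X in _ + X]mulNr.
- exact: (le_trans h2).
Qed.

Lemma leading_eq_bounded (n : nat -> nat) (u v : nat -> R) (c : R) :
  n @ \oo --> \oo -> (forall k, (0 < n k)%N -> `|u k - v k| <= c) ->
  leading_eq n u v.
Proof.
move=> noo h; apply/eqaddoP => e e0.
have [N hN] : exists N : nat, c / e <= N%:R.
  exists (Num.bound `|c / e|); apply: le_trans (ler_norm _) (ltW _).
  by rewrite archi_boundP.
have : \forall k \near \oo, (maxn N 1 <= n k)%N by exact: noo (nbhs_infty_ge _).
apply: filterS => k; rewrite geq_max => /andP[Nn n1].
rewrite (le_trans (h k n1)) // ger0_norm ?ler0n // -ler_pdivrMl //.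
by rewrite mulrC (le_trans hN) // ler_nat.
Qed.

Definition moment_bounded D (nu : probability (ket R D) R) :=
  pure_ensemble nu /\ ((2 <= D)%N -> forall i j : 'I_4 -> 'I_D,
    average nu (fun psi => complex.Re (moment_monomial i j psi)) <=
    (matched i j)%:R * (135 / ((D%:R - 1) ^+ 3 * D%:R))).

Lemma haar_moment_bounded D (mu : probability (ket R D) R) :
  haar mu -> moment_bounded mu.
Proof.
by move=> hmu; split=> [|D2 i j]; [exact: hmu.1|exact: haar_monomial_le].
Qed.

Lemma design_moment_bounded D (nu mu : probability (ket R D) R) :
  state_design 4 nu -> haar mu -> moment_bounded nu.
Proof.
move=> hnu hmu; split=> [|D2 i j]; first exact: hnu.1.
by rewrite (design_average_monomial i j hnu hmu) haar_monomial_le.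
Qed.

Lemma negativity_phases_moment_bounded (nA nB nC : nat -> nat)
    (nu : forall k, probability (ket R (2 ^ nA k * 2 ^ nB k * 2 ^ nC k)) R) :
  (fun k => nA k + nB k + nC k)%N @ \oo --> \oo ->
  (forall k, moment_bounded (nu k)) -> negativity_phases nu.
Proof.
move=> noo hnu.
have both (EN EN4 v : nat -> R) :
    (forall k, (0 < nA k + nB k + nC k)%N ->
       `|EN k - v k| <= gap /\ `|EN4 k - v k| <= gap) ->
    leading_eq (fun k => nA k + nB k + nC k)%N EN EN4 /\
    leading_eq (fun k => nA k + nB k + nC k)%N EN4 v.
  move=> h; split.
    apply: (@leading_eq_bounded _ _ _ (gap + gap)) => // k /h[h1 h2].
    rewrite -(subrKA (v k)) (le_trans (ler_normD _ _)) // lerD // distrC //.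
  by apply: (@leading_eq_bounded _ _ _ (gap)) => // k /h[].
have near k em er T v (n0 : (0 < nA k + nB k + nC k)%N) :=
  @negativity_averages_near (nA k) (nB k) (nC k) em er T v (nu k) n0 (hnu k).1
    ((hnu k).2 (ltac:(by rewrite -!expnD -[X in (X <= _)%N]expn1 leq_exp2l))).
split=> reg; apply: both => k n0.
- have := near k (nA k + nB k)%N (nA k + nB k)%N
    (nA k + nB k + 4 * nC k)%N 0 n0; rewrite mul0r; apply.
  + by move=> a b c /cycle_bounds_phase1; apply; exact/ltnW/reg.
  + by left.
  + by constructor 1.
  + lra.
  + lra.
- have [h1 h2 h3] := reg k.
  have {}h2 : (nA k <= nB k + nC k)%N.
    by rewrite -(ler_nat R) natrD; move: h2; rewrite !natrD; lra.
  have {}h3 : (nB k <= nA k + nC k)%N.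
    by rewrite -(ler_nat R) natrD; move: h3; rewrite !natrD; lra.
  apply: (near k (nC k) (nA k + nB k)%N (3 * nA k + 3 * nB k + 2 * nC k)%N
    (2^-1 * ((nA k + nB k)%N%:R - (nC k)%:R)) n0).
  + by move=> a b c /cycle_bounds_phase2; apply => //; exact: ltnW.
  + by right.
  + by constructor 1.
  + lra.
  + lra.
- have [h1 [hA|hB]] := reg k.
  + have {}hA : (nB k + nC k <= nA k)%N.
      by rewrite -(ler_nat R) natrD; move: hA; rewrite !natrD; lra.
    have -> : minn (nA k) (nB k) = nB k.
      by apply/minn_idPr/(leq_trans _ hA)/leq_addr.
    apply: (near k (nC k) (nB k + nB k + nC k)%N (4 * nA k + 2 * nB k + nC k)%N
      (nB k)%:R n0).
    * by move=> a b c /cycle_bounds_phase3; apply.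
    * by right.
    * by constructor 2.
    * lra.
    * lra.
  + have {}hB : (nA k + nC k <= nB k)%N.
      by rewrite -(ler_nat R) natrD; move: hB; rewrite !natrD; lra.
    have -> : minn (nA k) (nB k) = nA k.
      by apply/minn_idPl/(leq_trans _ hB)/leq_addr.
    apply: (near k (nC k) (nA k + nA k + nC k)%N (4 * nB k + 2 * nA k + nC k)%N
      (nA k)%:R n0).
    * move=> a b c /cycle_bounds_swap/cycle_bounds_phase3 h.
      by rewrite [X in (X + _ <= _)%N]addnC; apply: h.
    * by right.
    * by constructor 3.
    * lra.
    * lra.
Qed.

End Phases.

Theorem mainTheorem12 (R : realType) (a b c : R) (nA nB nC : nat -> nat)
    (mu : forall k : nat,
       probability (ket R (2 ^ nA k * 2 ^ nB k * 2 ^ nC k)) R) :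
  thermodynamic_limit a b c nA nB nC ->
  (forall k : nat, haar (mu k)) ->
  negativity_phases mu /\
  (forall nu : forall k : nat,
       probability (ket R (2 ^ nA k * 2 ^ nB k * 2 ^ nC k)) R,
     (forall k : nat, state_design 4 (nu k)) ->
     negativity_phases nu).
Proof.
move=> [noo _] hmu; split=> [|nu hnu].
  by apply: negativity_phases_moment_bounded => // k; exact: haar_moment_bounded.
apply: negativity_phases_moment_bounded => // k.
exact: design_moment_bounded (hnu k) (hmu k).
Qed.
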